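(* Let $\mathcal{G}$ be a bounded-degree Borel pmp graph on a standard probability space $(X,\mu)$. Then $\chi_\mu^{\mathrm{ap}}(\mathcal{G})\le\lfloor M(T_{\mathcal{G}})\rfloor+1$.
   Context: A Borel graph on $X$ is a simple undirected graph with Borel edge set in $X^2$; bounded degree means there is $d$ with $\deg(x)\le d$ for (almost) all $x$. $\mathcal{G}$ is pmp if every partial Borel bijection of $X$ whose graph is contained in the connectedness relation of $\mathcal{G}$ preserves $\mu$. $T_{\mathcal{G}}$ is the adjacency operator on $L^2(X,\mu)$, $(T_{\mathcal{G}}f)(x)=\sum_{y\sim x}f(y)$, and $M(T_{\mathcal{G}})=\sup_{f\neq0}\langle T_{\mathcal{G}}f,f\rangle/\langle f,f\rangle$ (the maximum of the spectrum). $\chi_\mu^{\mathrm{ap}}(\mathcal{G})$ is the least $k$ such that for every $\varepsilon>0$ there is a Borel $A\subseteq X$ with $\mu(A)>1-\varepsilon$ such that $\mathcal{G}\restriction A$ admits a $\mu$-measurable proper $k$-coloring. *)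

(* Defs.v *)
From HB Require Import structures.
From mathcomp Require Import all_boot all_order all_algebra.
From mathcomp Require Import all_classical all_reals all_analysis.
Set Implicit Arguments. Unset Strict Implicit. Unset Printing Implicit Defensive.
Import Order.TTheory GRing.Theory Num.Theory.
Import numFieldNormedType.Exports.
Local Open Scope classical_set_scope.
Local Open Scope ring_scope.

Inductive rt_closure {T : Type} (r : T -> T -> Prop) (x : T) : T -> Prop :=
| rt_refl : rt_closure r x x
| rt_step : forall y z, rt_closure r x y -> r y z -> rt_closure r x z.

Section Defs.
Context {d : measure_display} {X : measurableType d} {R : realType}.

Definition is_metric (dist : X -> X -> R) :=
  [/\ forall x y, 0 <= dist x y,
      forall x y, dist x y = 0 <-> x = y,
      forall x y, dist x y = dist y x &
      forall x y z, dist x z <= dist x y + dist y z].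

Definition metric_open (dist : X -> X -> R) (U : set X) :=
  forall x, U x -> exists2 r : R, 0 < r & (forall y, dist x y < r -> U y).

Definition metric_complete (dist : X -> X -> R) :=
  forall u : nat -> X,
    (forall e : R, 0 < e -> exists N, forall m n, (N <= m)%N -> (N <= n)%N ->
        dist (u m) (u n) < e) ->
    exists l, forall e : R, 0 < e -> exists N, forall n, (N <= n)%N -> dist (u n) l < e.

Definition metric_separable (dist : X -> X -> R) :=
  exists u : nat -> X, forall x (e : R), 0 < e -> exists n, dist x (u n) < e.

Definition standard_borel :=
  exists dist : X -> X -> R,
    [/\ is_metric dist, metric_complete dist, metric_separable dist &
        (@measurable _ X) = <<s [set U | metric_open dist U] >>].

Variable adj : X -> X -> Prop.

Definition borel_graph :=
  (forall x y, adj x y -> adj y x) /\ (forall x, ~ adj x x) /\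
  measurable [set p : X * X | adj p.1 p.2].

Definition neighbors (x : X) : set X := [set y | adj x y].

Definition deg_le (x : X) (n : nat) :=
  exists s : seq X, (size s <= n)%N /\ forall y, adj x y -> y \in s.

Definition bounded_degree (mu : {measure set X -> \bar R}) :=
  exists n : nat, {ae mu, forall x, deg_le x n}.

Definition connected_rel : X -> X -> Prop := rt_closure adj.

Definition partial_borel_bij (A B : set X) (f : X -> X) :=
  [/\ measurable A, measurable B, set_inj A f, f @` A = B &
      measurable_fun A f] /\
      (forall C, measurable C -> C `<=` A -> measurable (f @` C)).

Definition pmp (mu : {measure set X -> \bar R}) :=
  forall (A B : set X) (f : X -> X), partial_borel_bij A B f ->
    (forall x, A x -> connected_rel x (f x)) ->
    forall C, measurable C -> C `<=` A -> mu (f @` C) = mu C.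

Definition adj_op (f : X -> R) : X -> R := fun x => (\sum_(y \in neighbors x) f y)%R.

Definition L2_nonzero (mu : {measure set X -> \bar R}) (f : X -> R) :=
  [/\ measurable_fun setT f,
      mu.-integrable setT (fun x => ((f x) ^+ 2)%:E) &
      (\int[mu]_x ((f x) ^+ 2)%:E != 0)%E].

Definition inner (mu : {measure set X -> \bar R}) (f g : X -> R) : R :=
  fine (\int[mu]_x (f x * g x)%:E)%E.

Definition M_adj (mu : {measure set X -> \bar R}) : \bar R :=
  ereal_sup [set ((inner mu (adj_op f) f) / (inner mu f f))%:E | f in L2_nonzero mu].

(* mu-measurable sets: measurable for the completion of mu *)
Definition mu_measurable (mu : {measure set X -> \bar R}) (S : set X) :=
  exists B, measurable B /\ mu.-negligible ((S `\` B) `|` (B `\` S)).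

Definition mu_colorable_on (mu : {measure set X -> \bar R}) (A : set X) (k : nat) :=
  exists c : X -> 'I_k,
    (forall i : 'I_k, mu_measurable mu (A `&` (c @^-1` [set i]))) /\
    (forall x y, A x -> A y -> adj x y -> c x <> c y).

Definition ap_colorable (mu : {measure set X -> \bar R}) (k : nat) :=
  forall eps : R, 0 < eps -> exists A : set X,
    [/\ measurable A, (mu A > (1 - eps)%:E)%E & mu_colorable_on mu A k].

Definition chi_ap (mu : {measure set X -> \bar R}) : \bar R :=
  ereal_inf [set (k%:R)%:E | k in [set k : nat | ap_colorable mu k]].

End Defs.

(* Main.v *)
(* Let [k > M(T)]. For a Borel set [A] of positive measure, the Rayleigh quotient of its
   indicator is the average degree of the graph induced on [A], so the points of [A] with at
   least [k] neighbours in [A] form a set of measure at most [(M(T) / k) mu(A)]. Iterating,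
   the graph is peeled into layers in which every point has fewer than [k] neighbours in its
   own or later layers, up to a remainder of arbitrarily small measure. Each layer is a
   countable union of independent Borel sets; keeping finitely many of them, one colours
   greedily from the last layer to the first.

   The measurability rests on a capacity argument: up to a null set, the projection of a
   Borel subset of [X * X] is the union of the projections of countably many compact sets.
   It yields, almost everywhere, a decomposition of the graph into countably many disjoint
   Borel partial injections, hence the mass transport principle and the finiteness of [M(T)].
   Since the degree is bounded only almost everywhere, one must know that the neighbours of
   a null set form a null set. If not, some null set receives a map from a set of positive
   measure along edges, and the fibres of that map are large enough to admit infinitely many
   fibre-preserving injections with disjoint images, against the invariance of [mu]. *)

Require Import Defs.
From HB Require Import structures.
From mathcomp Require Import all_boot all_order all_algebra.
From mathcomp Require Import all_classical all_reals all_analysis.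
From mathcomp Require Import measurable_realfun.
From mathcomp Require Import ring lra.
Set Implicit Arguments. Unset Strict Implicit. Unset Printing Implicit Defensive.
Import Order.TTheory GRing.Theory Num.Theory.
Local Open Scope classical_set_scope.
Local Open Scope ring_scope.

(** * Analytic sets and compactness *)

Lemma prefix_choice (Q : seq nat -> nat -> Prop) :
  (forall s, exists a, Q s a) ->
  exists k : nat -> nat, forall n, Q (mkseq k n) (k n).
Proof.
move=> /choice[f Qf].
pose pre := fix pre n := if n is n'.+1 then rcons (pre n') (f (pre n')) else [::].
exists (f \o pre) => n.
suff -> : mkseq (f \o pre) n = pre n by exact: Qf.
by elim: n => // n IH; rewrite mkseqS IH.
Qed.

(** Basic neighbourhoods of Baire space [nat -> nat], in which closeness of codes is expressed. *)
Definition agree (M : nat) (a b : nat -> nat) := forall i, (i < M)%N -> a i = b i.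

(** König's lemma as compactness of a product of finite sets: a prefix shared by [al j] for
    arbitrarily large [j] has finitely many one-digit extensions allowed by [b], so one of these is
    again shared by arbitrarily late terms. *)
Lemma konig (b : nat -> nat) (al : nat -> nat -> nat) :
  (forall j i, (i < j)%N -> (al j i <= b i)%N) ->
  exists a, (forall i, (a i <= b i)%N) /\
    forall M N, exists2 j, (N <= j)%N & agree M a (al j).
Proof.
move=> alb.
pose inf s := forall N, exists2 j, (N <= j)%N & mkseq (al j) (size s) = s.
have [] := @prefix_choice (fun s a => inf s -> inf (rcons s a) /\ (a <= b (size s))%N).
  move=> s; apply: contrapT => /forallNP no.
  have infs : inf s by apply: contrapT => ni; apply: (no 0%N) => /ni.
  have {}no a : exists N, (a <= b (size s))%N ->
      forall j, (N <= j)%N -> mkseq (al j) (size s).+1 <> rcons s a.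
    apply: contrapT => /forallNP H; apply: (no a) => _; split.
      move=> N; apply: contrapT => H'; apply: (H N) => _ j Nj E.
      by apply: H'; exists j; rewrite ?size_rcons.
    by apply: contrapT => /negP ab; apply: (H 0%N) => /(negP ab).
  have {no}[N HN] := choice no.
  (* Each admissible digit [a] fails past [N a]. An index past all these thresholds, and past
     [size s] so that the bound [b] applies to it, extends [s] by its own digit. *)
  have [j Nj jE] := infs (maxn (size s).+1 (\max_(a < (b (size s)).+1) N a)).
  have sj : (size s < j)%N by rewrite (leq_trans _ Nj)// leq_maxl.
  have lb := alb _ _ sj.
  apply: (HN _ lb j); last by rewrite mkseqS jE.
  rewrite (leq_trans _ Nj)// (leq_trans _ (leq_maxr _ _))//.
  by rewrite -ltnS in lb; have := @leq_bigmax _ (fun a : 'I_(b (size s)).+1 => N a) (Ordinal lb).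
move=> a Ha.
have inf_a n : inf (mkseq a n).
  elim: n => [|n /Ha[]]; first by move=> N; exists N.
  by rewrite mkseqS.
exists a; split=> [i|M N].
  by have [_] := Ha i (inf_a i); rewrite size_mkseq.
have [j Nj] := inf_a M N; rewrite size_mkseq => E.
by exists j => // i iM; rewrite -(nth_mkseq 0%N a iM) -E nth_mkseq.
Qed.

Definition unpair (n : nat) : nat * nat := odflt (0, 0)%N (unpickle n).

Lemma unpairK p : unpair (pickle p) = p.
Proof. by rewrite /unpair pickleK. Qed.

Lemma small_inv (R : realType) (e : R) : 0 < e -> exists k : nat, k.+1%:R^-1 < e.
Proof.
move=> e0; exists (Num.truncn e^-1); rewrite invf_plt ?posrE//.
by case/andP: (truncn_itv (ltW (eqbRL (invr_gt0 e) e0))).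
Qed.

(** Standard Borel structure as data, so that everything below refers to one fixed metric and one
    dense sequence. *)
Record polish {d} (X : measurableType d) (R : realType) := Polish {
  pdist : X -> X -> R;
  pdense : nat -> X;
  pdist_metric : is_metric pdist;
  pdist_complete : metric_complete pdist;
  pdense_dense : forall x (e : R), 0 < e -> exists n, pdist x (pdense n) < e;
  pdist_borel : (@measurable _ X) = <<s [set U | metric_open pdist U] >> }.

Arguments pdist {d X R} p x y.
Arguments pdense {d X R} p n.
Arguments pdist_borel {d X R} p.
Arguments pdist_metric {d X R} p.
Arguments pdist_complete {d X R} p.
Arguments pdense_dense {d X R} p.

Section Polish.
Context {d} {X : measurableType d} {R : realType} (S : polish X R).
Local Notation dist := (pdist S).

Lemma pdist_ge0 x y : 0 <= dist x y.
Proof. by have [] := pdist_metric S. Qed.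

Lemma pdistxx x : dist x x = 0.
Proof. by have [_ + _ _] := pdist_metric S; move=> /(_ x x)[_]; apply. Qed.

Lemma pdist_eq0 x y : dist x y = 0 -> x = y.
Proof. by have [_ + _ _] := pdist_metric S; move=> /(_ x y)[]. Qed.

Lemma pdistC x y : dist x y = dist y x.
Proof. by have [] := pdist_metric S. Qed.

Lemma pdist_triangle y x z : dist x z <= dist x y + dist y z.
Proof. by have [] := pdist_metric S. Qed.

Definition metric_closed (F : set X) :=
  forall x, (forall e : R, 0 < e -> exists2 y, F y & dist x y < e) -> F x.

Lemma metric_closed_measurable F : metric_closed F -> measurable F.
Proof.
move=> cF; rewrite -(setCK F); apply: measurableC.
rewrite (pdist_borel S); apply: sub_gen_smallest => /= x nFx.
apply: contrapT => H; apply: nFx; apply: cF => e e0.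
apply: contrapT => H'; apply: H; exists e => // y xy Fy; apply: H'; by exists y.
Qed.

Lemma metric_closed1 y : metric_closed [set y].
Proof.
move=> x H; apply: pdist_eq0; apply: contrapT => /eqP xy.
have [|z -> ] := H (dist x y); last by rewrite ltxx.
by rewrite lt_neqAle eq_sym xy pdist_ge0.
Qed.

(** Closedness in the product of Baire space with [X * X]. *)
Definition closed_relation (P : (nat -> nat) -> X -> X -> Prop) :=
  forall a x y, (forall M (e : R), 0 < e -> exists a' x' y',
    [/\ agree M a a', dist x x' < e, dist y y' < e & P a' x' y']) -> P a x y.

(** Digit [k] of a code confines both points to sets of diameter at most [2 / (k + 1)]; hence
    convergence of codes forces convergence of the coded points. *)
Definition localized (P : (nat -> nat) -> X -> X -> Prop) :=
  forall k a x y a' x' y', P a x y -> P a' x' y' -> a k = a' k ->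
    dist x x' <= 2 * k.+1%:R^-1 /\ dist y y' <= 2 * k.+1%:R^-1.

Definition shadow (P : (nat -> nat) -> X -> X -> Prop) : set (X * X) :=
  [set p | exists a, P a p.1 p.2].

(** Souslin's definition: the projection of a closed set along Baire space. *)
Definition analytic (F : set (X * X)) :=
  exists2 P, closed_relation P & F = shadow P.

(** The first digit of a code selects the index [n]; the remaining digits are a code for [F n]. *)
Lemma analytic_bigcup (F : nat -> set (X * X)) :
  (forall n, analytic (F n)) -> analytic (\bigcup_n F n).
Proof.
move=> aF; have /choice[P HP] n : exists P, closed_relation P /\ F n = shadow P.
  by have [P cP ->] := aF n; exists P.
exists (fun a x y => P (a 0%N) (a \o succn) x y).
  move=> a x y H; have [cP _] := HP (a 0%N).
  apply: cP => M e e0; have [a' [x' [y' [aa' xx' yy' Pa]]]] := H M.+1 e e0.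
  exists (a' \o succn), x', y'; split => //; first by move=> i iM; exact: aa'.
  by rewrite (aa' 0%N).
apply/seteqP; split => -[x y].
  move=> [n _]; have [_ ->] := HP n => -[a Pa] /=.
  by exists (fun i => if i is i'.+1 then a i' else n).
by move=> [a Pa]; exists (a 0%N) => //; have [_ ->] := HP (a 0%N); exists (a \o succn).
Qed.

(** A single code is split by the pairing [pickle] into countably many codes, one for each [F n]. *)
Lemma analytic_bigcap (F : nat -> set (X * X)) :
  (forall n, analytic (F n)) -> analytic (\bigcap_n F n).
Proof.
move=> aF; have /choice[P HP] n : exists P, closed_relation P /\ F n = shadow P.
  by have [P cP ->] := aF n; exists P.
exists (fun a x y => forall n, P n (fun i => a (pickle (n, i))) x y).
  move=> a x y H n; have [cP _] := HP n.
  apply: cP => M e e0.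
  have [a' [x' [y' [aa' xx' yy' Pa]]]] := H (\max_(i < M) (pickle (n, i : nat))).+1 e e0.
  exists (fun i => a' (pickle (n, i))), x', y'; split => // i iM; apply: aa'.
  by rewrite ltnS (leq_bigmax (F := fun i : 'I_M => pickle (n, i : nat)) (Ordinal iM)).
apply/seteqP; split => -[x y].
  move=> Fxy; have /choice[b Pb] n : exists a, P n a x y.
    by have [_ E] := HP n; have := Fxy n I; rewrite E.
  exists (fun j => b (unpair j).1 (unpair j).2) => n /=.
  by under eq_fun do rewrite unpairK; exact: Pb.
by move=> [a Pa] n _; have [_ ->] := HP n; exists (fun i => a (pickle (n, i))); exact: Pa.
Qed.

Lemma analytic_closed_prod (F G : set X) :
  metric_closed F -> metric_closed G -> analytic (F `*` G).
Proof.
move=> cF cG; exists (fun _ x y => F x /\ G y); last first.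
  by apply/seteqP; split => -[x y]; [exists id | case].
by move=> a x y H; split; [apply: cF|apply: cG] => e e0;
  have [_ [x' [y' [_ xx' yy' [Fx' Gy']]]]] := H 0%N e e0; [exists x'|exists y'].
Qed.

Lemma metric_openF U : metric_open dist U ->
  exists2 F : nat -> set X, (forall n, metric_closed (F n)) & U = \bigcup_n F n.
Proof.
move=> oU; exists (fun n => [set x | forall y, dist x y < n.+1%:R^-1 -> U y]).
  move=> n x H y xy.
  have [|z Hz xz] := H (n.+1%:R^-1 - dist x y); first by rewrite subr_gt0.
  apply: Hz; have := pdist_triangle x z y; rewrite (pdistC z x).
  by move: (n.+1%:R^-1) xz {xy H} => r ? ?; lra.
apply/seteqP; split => [x /oU[r r0 Hr]|x [n _]]; last first.
  by apply; rewrite pdistxx invr_gt0.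
have [n nr] := small_inv r0; exists n => // y /= xy; apply: Hr.
exact: lt_trans nr.
Qed.

Lemma metric_closedT : metric_closed setT. Proof. by []. Qed.

(** Analytic sets need not be stable under complement; imposing analyticity on the complement as
    well yields a sigma-algebra. *)
Definition bianalytic F := analytic F /\ analytic (~` F).

Lemma bianalytic_sigma_algebra : sigma_algebra setT bianalytic.
Proof.
have a0 : analytic set0.
  exists (fun _ _ _ => False); first by move=> a x y /(_ 0%N 1 ltr01)[? [? [? []]]].
  by apply/seteqP; split => // p [].
have aT : analytic setT.
  by rewrite -setXTT; exact: analytic_closed_prod.
split=> [|F [aF aFc]|F aF].
- by rewrite /bianalytic setC0.
- by rewrite setTD /bianalytic setCK.
- split; first by apply: analytic_bigcup => n; have [] := aF n.
  by rewrite setC_bigcup; apply: analytic_bigcap => n; have [] := aF n.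
Qed.

Lemma bianalytic_preimage (f : X * X -> X) :
  (forall U, metric_closed U -> analytic (f @^-1` U)) ->
  forall U, measurable U -> bianalytic (f @^-1` U).
Proof.
move=> cf; rewrite (pdist_borel S); apply: smallest_sub => [|U oU].
  have [b0 bC bU] := bianalytic_sigma_algebra.
  split=> [|F /= bF|F /= bF]; first by rewrite preimage_set0.
    by rewrite setTD preimage_setC -setTD; exact: bC.
  by rewrite preimage_bigcup; exact: bU.
split; last first.
  rewrite preimage_setC; apply: cf => x H nUx.
  have [r r0 Hr] := oU _ nUx; have [y nUy xy] := H _ r0.
  by apply: nUy; exact: Hr.
have [F cF ->] := metric_openF oU; rewrite preimage_bigcup.
by apply: analytic_bigcup => n; exact: cf.
Qed.

Lemma measurable_analytic (F : set (X * X)) : measurable F -> analytic F.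
Proof.
suff : measurable `<=` bianalytic by move=> H /H[].
apply: smallest_sub; first exact: bianalytic_sigma_algebra.
move=> _ [|] [U mU <-]; rewrite setTI; apply: bianalytic_preimage => // V cV.
  by rewrite -[_ @^-1` _]/(fst @^-1` V) -setXT; exact: analytic_closed_prod.
by rewrite -[_ @^-1` _]/(snd @^-1` V) -setTX; exact: analytic_closed_prod.
Qed.

Definition cball (i : nat) : set X :=
  [set x | dist x (pdense S (unpair i).1) <= (unpair i).2.+1%:R^-1].

Lemma cball_closed i : metric_closed (cball i).
Proof.
move=> x H; rewrite /cball /= leNgt; apply/negP => lt.
have [|y] := H (dist x (pdense S (unpair i).1) - (unpair i).2.+1%:R^-1).
  by rewrite subr_gt0.
rewrite /cball /= => yi xy.
have := pdist_triangle y x (pdense S (unpair i).1).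
by move: (_.+1%:R^-1) yi xy {H lt} => r; lra.
Qed.

Lemma cball_cover x k : exists2 i, (unpair i).2 = k & cball i x.
Proof.
have [|n xn] := pdense_dense S x k.+1%:R^-1; first by rewrite invr_gt0.
by exists (pickle (n, k)); rewrite ?unpairK// /cball /= unpairK ltW.
Qed.

Lemma cball_dist i x y : cball i x -> cball i y -> dist x y <= 2 * (unpair i).2.+1%:R^-1.
Proof.
rewrite /cball /= => xi yi.
have := pdist_triangle (pdense S (unpair i).1) x y.
by rewrite (pdistC (pdense S _) y); move: (_.+1%:R^-1) xi yi => r; lra.
Qed.

(** Digit [k] of the new code stores digit [k] of the old one together with the centres of two balls
    of radius [1 / (k + 1)] containing [x] and [y]. *)
Lemma analytic_localize F : analytic F ->
  exists P, [/\ closed_relation P, localized P & F = shadow P].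
Proof.
move=> [P cP ->].
pose p a (k : nat) := (unpair (a k)).1.
pose q1 a (k : nat) := (unpair (unpair (a k)).2).1.
pose q2 a (k : nat) := (unpair (unpair (a k)).2).2.
exists (fun a x y => P (p a) x y /\
  forall k, cball (pickle (q1 a k, k)) x /\ cball (pickle (q2 a k, k)) y); split.
- move=> a x y H; split.
    apply: cP => M e /(H M)[a' [x' [y' [aa' xx' yy' [Pa _]]]]].
    exists (p a'), x', y'; split => // i iM; by rewrite /p aa'.
  move=> k; split; apply: cball_closed => e /(H k.+1)[a' [x' [y' [aa' xx' yy' [_ V]]]]].
    by exists x' => //; rewrite /q1 aa'//; have [] := V k.
  by exists y' => //; rewrite /q2 aa'//; have [] := V k.
- move=> k a x y a' x' y' [_ Va] [_ Va'] E.
  have [Vx Vy] := Va k; have [] := Va' k; rewrite /q1 /q2 -E => Vx' Vy'.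
  by have := cball_dist Vx Vx'; have := cball_dist Vy Vy'; rewrite !unpairK.
- apply/seteqP; split => -[x y] [a]; last by case=> Pa _; exists (p a).
  move=> Pa.
  have Eb1 (k : nat) : exists n : nat, cball (pickle (n, k)) x.
    have [i ik xi] := cball_cover x k; exists (unpair i).1.
    by move: xi; rewrite /cball /= unpairK /= ik.
  have Eb2 (k : nat) : exists n : nat, cball (pickle (n, k)) y.
    have [i ik xi] := cball_cover y k; exists (unpair i).1.
    by move: xi; rewrite /cball /= unpairK /= ik.
  have [b1 Hb1] := choice Eb1; have [b2 Hb2] := choice Eb2.
  exists (fun k => pickle (a k, pickle (b1 k, b2 k))); split.
    by rewrite (_ : p _ = a)//; apply/funext => k; rewrite /p unpairK.
  by move=> k; rewrite /q1 /q2 !unpairK; split; [exact: Hb1|exact: Hb2].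
Qed.

(** König's lemma gives a limit code. Along a subsequence the codes agree with it on ever longer
    prefixes, so by localization the points are Cauchy, and closedness puts the limit in [P]. *)
Lemma shadow_compact P (b : nat -> nat) (al : nat -> nat -> nat) (xs ys : nat -> X) :
  closed_relation P -> localized P ->
  (forall j, P (al j) (xs j) (ys j)) ->
  (forall j i, (i < j)%N -> (al j i <= b i)%N) ->
  exists a x y, [/\ P a x y, forall i, (a i <= b i)%N &
    forall e : R, 0 < e -> forall N, exists2 j, (N <= j)%N &
      dist x (xs j) < e /\ dist y (ys j) < e].
Proof.
move=> cP lP HP /konig[a [ab Ha]].
have /choice[f Hf] M : exists j, (M <= j)%N /\ agree M a (al j).
  by have [j Mj aj] := Ha M M; exists j.
have near_f e : 0 < e -> exists N, forall m n, (N <= m)%N -> (N <= n)%N ->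
    dist (xs (f m)) (xs (f n)) < e /\ dist (ys (f m)) (ys (f n)) < e.
  move=> e0; have [|k ke] := @small_inv _ (e / 2); first lra.
  exists k.+1 => m n km kn.
  have [_ /(_ k km) am] := Hf m; have [_ /(_ k kn) an] := Hf n.
  have := lP k _ _ _ _ _ _ (HP (f m)) (HP (f n)).
  rewrite -am -an => /(_ erefl) []; move: (_.+1%:R^-1) ke => r; split; lra.
have [|x Hx] := pdist_complete S (xs \o f).
  by move=> e /near_f[N HN]; exists N => m n /HN H /H[].
have [|y Hy] := pdist_complete S (ys \o f).
  by move=> e /near_f[N HN]; exists N => m n /HN H /H[].
have near_lim e : 0 < e -> forall N, exists2 n, (N <= n)%N &
    dist x (xs (f n)) < e /\ dist y (ys (f n)) < e.
  move=> e0 N; have [N1 H1] := Hx e e0; have [N2 H2] := Hy e e0.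
  exists (maxn N (maxn N1 N2)); first by rewrite leq_maxl.
  rewrite ![dist x _]pdistC ![dist y _]pdistC.
  split; [apply: H1|apply: H2]; by rewrite !leq_max leqnn !orbT.
exists a, x, y; split => //.
  apply: cP => M e e0; have [n Mn [? ?]] := near_lim e e0 M.
  exists (al (f n)), (xs (f n)), (ys (f n)); split => // i iM.
  by have [_] := Hf n; apply; exact: leq_trans Mn.
move=> e e0 N; have [n Nn H] := near_lim e e0 N; exists (f n) => //.
by have [fn _] := Hf n; exact: leq_trans fn.
Qed.

End Polish.

(** * Capacitability *)

Section Hull.
Context {d} {X : measurableType d} {R : realType} (mu : probability X R).
Local Open Scope ereal_scope.

Definition is_hull (A H : set X) := [/\ measurable H, A `<=` H &
  forall B, measurable B -> A `<=` B -> mu (H `\` B) = 0].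

(** Intersect measurable supersets whose measures approach the outer measure of [A]. *)
Lemma hull_exists A : exists H, is_hull A H.
Proof.
pose I := [set mu B | B in [set B | measurable B /\ A `<=` B]].
have I0 : 0 <= ereal_inf I by apply: le_ereal_inf_tmp => _ [B _ <-].
have I1 : ereal_inf I \is a fin_num.
  rewrite ge0_fin_numE//; apply: (@le_lt_trans _ _ (mu setT)); last first.
    by rewrite probability_setT ltry.
  by apply: ereal_inf_lbound; exists setT.
have /choice[B HB] (n : nat) : exists B, [/\ measurable B, A `<=` B &
    mu B < ereal_inf I + n.+1%:R^-1%:E].
  have [|_ [B [mB AB] <-] lt] := @lb_ereal_inf_adherent _ I n.+1%:R^-1 _ I1.
    by rewrite invr_gt0.
  by exists B.
have mH : measurable (\bigcap_n B n).
  by apply: bigcap_measurableType => n _; have [] := HB n.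
have HI : mu (\bigcap_n B n) <= ereal_inf I.
  apply/lee_addgt0Pr => e e0; have [n ne] := small_inv e0.
  have [mB _ lt] := HB n.
  apply: (@le_trans _ _ (mu (B n))).
    by apply: le_measure; rewrite ?inE// => x; exact.
  by apply: ltW; apply: lt_le_trans lt _; rewrite leeD2l// lee_fin ltW.
exists (\bigcap_n B n); split => //; first by move=> x Ax n _; have [_ + _] := HB n; exact.
move=> C mC AC; rewrite measureD//; last first.
  by rewrite (le_lt_trans HI)// -ge0_fin_numE.
apply/eqP; rewrite eq_le; apply/andP; split.
  rewrite leeBlDr; last first.
    rewrite ge0_fin_numE// (@le_lt_trans _ _ (mu setT))//.
      by rewrite le_measure ?inE//; exact: measurableI.
    by rewrite probability_setT ltry.
  rewrite add0e (le_trans HI)//; apply: ereal_inf_lbound; exists (\bigcap_n B n `&` C) => //.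
  split; first exact: measurableI.
  move=> x Ax; split; last exact: AC.
  by move=> n _; have [_ + _] := HB n; exact.
by rewrite -measureD// (le_lt_trans HI)// -ge0_fin_numE.
Qed.

Definition hull A := sval (cid (hull_exists A)).

Lemma hullP A : is_hull A (hull A).
Proof. exact: svalP. Qed.

Lemma hull_measurable A : measurable (hull A).
Proof. by have [] := hullP A. Qed.

Lemma sub_hull A : A `<=` hull A.
Proof. by have [] := hullP A. Qed.

Lemma hull_min A B : measurable B -> A `<=` B -> mu (hull A `\` B) = 0.
Proof. by have [_ _] := hullP A; exact. Qed.

(** Continuity from below of the outer measure, for sets that need not be measurable. *)
Lemma hull_continuous (A : nat -> set X) (e : R) : (0 < e)%R ->
  (forall n, A n `<=` A n.+1) ->
  exists n, mu (hull (\bigcup_n A n) `\` hull (A n)) < e%:E.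
Proof.
move=> e0 ndA.
have leA n m : (n <= m)%N -> A n `<=` A m.
  move=> /subnKC <-; elim: (m - n)%N => [|k IH]; first by rewrite addn0.
  by rewrite addnS; apply: subset_trans (ndA _).
(* Hulls of increasing sets increase only up to null sets. Intersecting the later hulls gives a
   truly increasing sequence, still between [A n] and its hull. *)
pose L n := \bigcap_(k in [set k | (n <= k)%N]) hull (A k).
have mL n : measurable (L n) by apply: bigcap_measurableType => k _; exact: hull_measurable.
have AL n : A n `<=` L n by move=> x Ax k /= nk; apply: sub_hull; exact: leA Ax.
pose G n := hull (\bigcup_n A n) `\` L n.
have mG n : measurable (G n) by apply: measurableD => //; exact: hull_measurable.
have G0 : mu (\bigcap_n G n) = 0.
  have mU : measurable (\bigcup_n L n) by exact: bigcupT_measurable.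
  apply: (@subset_measure0 _ _ _ _ _ (hull (\bigcup_n A n) `\` \bigcup_n L n)).
  - exact: bigcap_measurableType.
  - by apply: measurableD => //; exact: hull_measurable.
  - move=> x Gx; split; first by have [] := Gx 0%N I.
    by move=> [n _ Lx]; have [_] := Gx n I.
  - by apply: hull_min => // x [n _ Ax]; exists n => //; exact: AL.
have : mu (G n) @[n --> \oo] --> 0.
  rewrite -G0; apply: nonincreasing_cvg_mu => //.
  - by rewrite (@le_lt_trans _ _ (mu setT))// ?le_measure ?inE// probability_setT ltry.
  - exact: bigcap_measurableType.
  - apply/nonincreasing_seqP => n; apply/subsetPset => x [Ux nL]; split => //.
    by apply: contra_not nL => Lx k nk; apply: Lx => /=; exact: leq_trans nk.
move=> /fine_cvgP[_ /cvgrPdist_lt/(_ _ e0)[N _ /(_ N)/= /(_ (leqnn N))]].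
rewrite sub0r normrN ger0_norm ?fine_ge0// => lt; exists N.
have fG : mu (G N) \is a fin_num by exact: fin_num_measure.
rewrite -(fineK fG) -lte_fin fineK// in lt.
apply: le_lt_trans lt; apply: le_measure; rewrite ?inE//.
  by apply: measurableD; exact: hull_measurable.
by apply: setDS => x; apply => /=.
Qed.

End Hull.

(** * Inner approximation of projections by compact sets *)

Section Capacity.
Context {d} {X : measurableType d} {R : realType} (S : polish X R).
Variable mu : probability X R.
Local Notation dist := (pdist S).

Definition proj1 (K : set (X * X)) (C : set X) : set X :=
  [set x | exists2 y, C y & K (x, y)].
Definition proj2 (K : set (X * X)) (C : set X) : set X :=
  [set y | exists2 x, C x & K (x, y)].

(** Stands in for compactness of [K]: a compact set meets a closed cylinder in a compact set, whose
    projections are closed. *)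
Definition closed_projections (K : set (X * X)) := forall C,
  metric_closed S C -> metric_closed S (proj1 K C) /\ metric_closed S (proj2 K C).

Lemma metric_closure (A : set X) : exists B, [/\ metric_closed S B, A `<=` B &
  forall x, B x -> forall e, 0 < e -> exists2 y, A y & dist x y < e].
Proof.
exists [set x | forall e : R, 0 < e -> exists2 y, A y & dist x y < e]; split => //.
  move=> x H e e0; have [|y Hy xy] := H (e / 2); first lra.
  have [|z Az yz] := Hy (e / 2); first lra.
  by exists z => //; have := pdist_triangle S y x z; lra.
by move=> x Ax e e0; exists x; rewrite ?pdistxx.
Qed.

Lemma pdist_cluster_eq (xs : nat -> X) x x' :
  (forall j, dist x (xs j) < j.+1%:R^-1) ->
  (forall e : R, 0 < e -> forall N, exists2 j, (N <= j)%N & dist x' (xs j) < e) ->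
  x = x'.
Proof.
move=> Hx lim.
apply: (@pdist_eq0 _ _ _ S); apply/eqP; rewrite eq_le pdist_ge0 andbT.
apply/ler_addgt0Pr => e e0; rewrite add0r.
have [|N Ne] := @small_inv _ (e / 2); first lra.
have [|j Nj xj] := lim (e / 2) _ N; first lra.
have xqj := Hx j.
have : j.+1%:R^-1 <= N.+1%:R^-1 :> R by rewrite lef_pV2 ?posrE ?ltr0n// ler_nat.
have := pdist_triangle S (xs j) x x'; rewrite (pdistC S (xs j) x').
by move: (N.+1%:R^-1) (j.+1%:R^-1) Ne xqj => r s; lra.
Qed.

Lemma compact_closed_proj1 P (k : nat -> nat) C :
  closed_relation S P -> localized S P -> metric_closed S C ->
  metric_closed S
    (proj1 [set p | exists2 a, P a p.1 p.2 & forall i, (a i <= k i)%N] C).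
Proof.
move=> cP lP cC x Hz.
have {}Hz (n : nat) : exists q : (nat -> nat) * (X * X),
    [/\ P q.1 q.2.1 q.2.2, forall i, (q.1 i <= k i)%N, C q.2.2 & dist x q.2.1 < n.+1%:R^-1].
  have [|x' [y Cy [a Pa ak]] xx'] := Hz n.+1%:R^-1; first by rewrite invr_gt0.
  by exists (a, (x', y)).
have [q Hq] := choice Hz.
have [||a [x' [y' [Pa ak lim]]]] := @shadow_compact _ _ _ S P k
  (fun j => (q j).1) (fun j => (q j).2.1) (fun j => (q j).2.2) cP lP.
- by move=> j; have [] := Hq j.
- by move=> j i _; have [_ + _ _] := Hq j; apply.
have xE : x = x'.
  apply: (@pdist_cluster_eq (fun j => (q j).2.1)).
    by move=> j; have [] := Hq j.
  by move=> e1 /lim H N; have [j Nj []] := H N; exists j.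
exists y'; last by rewrite xE; exists a.
apply: cC => e e0; have [j _ [_ yj]] := lim e e0 0%N.
by exists (q j).2.2 => //; have [] := Hq j.
Qed.

Lemma compact_closed_projections P (k : nat -> nat) :
  closed_relation S P -> localized S P ->
  closed_projections [set p | exists2 a, P a p.1 p.2 & forall i, (a i <= k i)%N].
Proof.
move=> cP lP C cC; split; first exact: compact_closed_proj1.
apply: (@compact_closed_proj1 (fun a x y => P a y x)) => //.
  move=> a x y H; apply: cP => M e /(H M)[a' [x' [y' [? ? ? ?]]]].
  by exists a', y', x'.
by move=> n a x y a' x' y' Pa Pa' E; have [] := lP n _ _ _ _ _ _ Pa Pa' E.
Qed.

(* Choquet's capacitability argument: bounding the Baire coordinates one at a time
   loses little outer measure, and compactness turns the limit of the closures of the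
   successive projections into the projection of a compact set. *)
Lemma capacitability F (e : R) : analytic S F -> 0 < e ->
  exists K, [/\ K `<=` F, closed_projections K &
    (mu (hull mu (proj1 F setT) `\` proj1 K setT) <= e%:E)%E].
Proof.
move=> /analytic_localize[P [cP lP ->]] e0.
pose T s := [set x | exists y a, P a x y /\ forall i, (i < size s)%N -> (a i <= nth 0%N s i)%N].
have TS s : T s = \bigcup_n T (rcons s n).
  apply/seteqP; split => x [].
    move=> y [a [Pa H]]; exists (a (size s)) => //; exists y, a; split => // i.
    by rewrite size_rcons nth_rcons ltnS leq_eqVlt => /predU1P[->|lt];
      rewrite ?ltnn ?eqxx// lt; exact: H.
  move=> n _ [y [a [Pa H]]]; exists y, a; split => // i lt.
  by have := H i; rewrite size_rcons nth_rcons lt ltnS; apply; exact: ltnW.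
have TT s n : T (rcons s n) `<=` T (rcons s n.+1).
  move=> x [y [a [Pa H]]]; exists y, a; split => // i.
  rewrite size_rcons nth_rcons ltnS leq_eqVlt => /predU1P[->|lt];
    rewrite ?ltnn ?eqxx.
    by have := H (size s); rewrite size_rcons nth_rcons ltnn eqxx => /(_ (ltnSn _))/leqW.
  by rewrite lt; have := H i; rewrite size_rcons nth_rcons lt; apply; exact: ltnW.
(* The digit bounds [k] are chosen successively; the losses [e / 2 ^ (j + 1)] add up to [e]. *)
have [s|k Hk] := @prefix_choice (fun s n =>
    (mu (hull mu (T s) `\` hull mu (T (rcons s n))) < (e / (2 ^ (size s).+1)%:R)%:E)%E).
  rewrite [in hull mu (T s)](TS s); apply: hull_continuous => //.
  by rewrite divr_gt0// ltr0n expn_gt0.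
pose K := [set p : X * X | exists2 a, P a p.1 p.2 & forall i, (a i <= k i)%N].
have cK : closed_projections K by exact: compact_closed_projections.
exists K; split => //; first by move=> p [a Pa _]; exists a.
pose U j := T (mkseq k j).
have US j : (mu (hull mu (U j) `\` hull mu (U j.+1)) <= (e / (2 ^ j.+1)%:R)%:E)%E.
  by have := ltW (Hk j); rewrite size_mkseq /U mkseqS.
have U0 : U 0%N = proj1 (shadow P) setT.
  apply/seteqP; split => x; first by move=> [y [a [Pa _]]]; exists y => //; exists a.
  by move=> [y _ [a Pa]]; exists y, a; split.
have /choice[cl Hcl] (j : nat) := metric_closure (U j).
have mcl j : measurable (cl j) by apply: (@metric_closed_measurable _ _ _ S); have [] := Hcl j.
(* A point in all the closures is approximated by points whose codes obey more and more of the
   bounds [k]; compactness yields a limit code obeying all of them. *)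
have clK : \bigcap_j cl j `<=` proj1 K setT.
  move=> x Hx; have {}Hx (j : nat) : exists q : (nat -> nat) * (X * X),
      [/\ P q.1 q.2.1 q.2.2, forall i, (i < j)%N -> (q.1 i <= k i)%N &
        dist x q.2.1 < j.+1%:R^-1].
    have [_ _ H] := Hcl j; have [|x' [y [a [Pa aj]]] xx'] := H x (Hx j I) j.+1%:R^-1.
      by rewrite invr_gt0.
    exists (a, (x', y)); split => // i ij.
    by have := aj i; rewrite size_mkseq nth_mkseq//; exact.
  have [q Hq] := choice Hx.
  have [||a [x' [y' [Pa ak lim]]]] := @shadow_compact _ _ _ S P k
    (fun j => (q j).1) (fun j => (q j).2.1) (fun j => (q j).2.2) cP lP.
  - by move=> j; have [] := Hq j.
  - by move=> j i; have [_ + _] := Hq j; apply.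
  have xE : x = x'.
  apply: (@pdist_cluster_eq (fun j => (q j).2.1)).
    by move=> j; have [] := Hq j.
  by move=> e1 /lim H N; have [j Nj []] := H N; exists j.
  by exists y' => //; rewrite xE; exists a.
have mK : measurable (proj1 K setT).
  by apply: (@metric_closed_measurable _ _ _ S); have [] := cK setT.
have mD A B : measurable (hull mu A `\` hull mu B).
  by apply: measurableD; exact: hull_measurable.
have mN j : measurable (hull mu (U j) `\` cl j).
  by apply: measurableD => //; exact: hull_measurable.
have N0 j : mu (hull mu (U j) `\` cl j) = 0.
  by apply: hull_min => //; have [] := Hcl j.
pose G j := hull mu (U j) `\` hull mu (U j.+1).
pose N j := hull mu (U j) `\` cl j.
have mbG : measurable (\bigcup_j G j) by apply: bigcupT_measurable => j; exact: mD.
have mbN : measurable (\bigcup_j N j) by exact: bigcupT_measurable.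
apply: (@le_trans _ _ (mu (\bigcup_j G j `|` \bigcup_j N j))).
  apply: le_measure; rewrite ?inE//.
  - by apply: measurableD => //; exact: hull_measurable.
  - exact: measurableU.
  (* A point of the hull of [U 0] that avoids every gap [G j] stays in every hull, and if it also
     avoids every [N j] it lies in every closure. *)
  move=> x []; rewrite -U0 => Hx0 nK; apply: contrapT => /not_orP[nG nN]; apply: nK.
  have HU j : hull mu (U j) x.
    elim: j => // j IH; apply: contrapT => nj; apply: nG; by exists j.
  by apply: clK => j _; apply: contrapT => nj; apply: nN; exists j.
rewrite measureU0//; last first.
  apply: measure_negligible => //; apply: negligible_bigcup => j.
  by apply/negligibleP; [exact: mN|exact: N0].
have mG j : measurable (G j) by exact: mD.
apply: le_trans (measure_sigma_subadditive mu mG mbG (@subset_refl _ _)) _.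
apply: le_trans (@epsilon_trick0 R e xpredT (ltW e0)).
by apply: lee_nneseries => // j _; exact: US.
Qed.

Lemma negligible_small (A : set X) : (forall e : R, 0 < e ->
  exists B, [/\ measurable B, A `<=` B & (mu B <= e%:E)%E]) -> mu.-negligible A.
Proof.
move=> H; exists (hull mu A); split; [exact: hull_measurable| |exact: sub_hull].
apply/eqP; rewrite -measure_le0; apply/lee_addgt0Pr => e e0; rewrite add0e.
have [B [mB AB Be]] := H e e0; apply: le_trans Be.
have mH := hull_measurable mu A.
rewrite -(@measureU0 _ _ _ mu B (hull mu A `\` B))//; last exact: hull_min.
  apply: le_measure; rewrite ?inE//; first by apply: measurableU => //; exact: measurableD.
  by move=> x Hx; have [|] := pselect (B x); [left|right].
exact: measurableD.
Qed.

Lemma measurable_inner_compact E : measurable E -> exists K : nat -> set (X * X),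
  [/\ forall n, K n `<=` E, forall n, closed_projections (K n) &
    mu.-negligible (proj1 E setT `\` \bigcup_n proj1 (K n) setT)].
Proof.
move=> /(measurable_analytic S) aE.
have inv_gt0 n : 0 < n.+1%:R^-1 :> R by rewrite invr_gt0.
have /choice[K HK] (n : nat) := capacitability aE (inv_gt0 n).
have mK n : measurable (proj1 (K n) setT).
  apply: (@metric_closed_measurable _ _ _ S); have [_ + _] := HK n.
  by move=> /(_ _ (@metric_closedT _ _ _ S))[].
exists K; split; [by move=> n; have [] := HK n|by move=> n; have [] := HK n|].
apply: negligible_small => e e0; have [n ne] := small_inv e0.
exists (hull mu (proj1 E setT) `\` proj1 (K n) setT); split.
- by apply: measurableD => //; exact: hull_measurable.
- move=> x [Ex nK]; split; first exact: sub_hull.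
  by move=> Kx; apply: nK; exists n.
- have [_ _ H] := HK n; apply: le_trans H _; by rewrite lee_fin ltW.
Qed.

End Capacity.

(** * Graphs of partial injections *)

Section Graphs.
Context {d} {X : measurableType d} {R : realType} (S : polish X R).
Variable mu : probability X R.

Definition functional (K : set (X * X)) :=
  forall x y y', K (x, y) -> K (x, y') -> y = y'.
Definition cofunctional (K : set (X * X)) :=
  forall x x' y, K (x, y) -> K (x', y) -> x = x'.
Definition borel_projections (K : set (X * X)) := forall C, measurable C ->
  measurable (proj1 K C) /\ measurable (proj2 K C).

(** Preimages under a partial function commute with relative complements and countable unions, so it
    suffices to treat closed sets. *)
Lemma functional_proj1_measurable K : functional K ->
  (forall C, metric_closed S C -> measurable (proj1 K C)) ->
  forall C, measurable C -> measurable (proj1 K C).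
Proof.
move=> fK cK.
have mT : measurable (proj1 K setT) by apply: cK; exact: metric_closedT.
have bigU (F : nat -> set X) : proj1 K (\bigcup_n F n) = \bigcup_n proj1 K (F n).
  apply/seteqP; split => x; first by move=> [y [n _ Fy] Kxy]; exists n => //; exists y.
  by move=> [n _ [y Fy Kxy]]; exists y => //; exists n.
suff : @measurable _ X `<=` [set C | measurable (proj1 K C)] by [].
rewrite [X in X `<=` _](pdist_borel S); apply: smallest_sub.
  split=> [|C mC|F mF] /=.
  - rewrite (_ : proj1 K set0 = set0)//; by apply/seteqP; split => // x [y []].
  - rewrite (_ : proj1 K _ = proj1 K setT `\` proj1 K C); first exact: measurableD.
    apply/seteqP; split => x.
      move=> [y [_ nCy] Kxy]; split; first by exists y.
      by move=> [y' Cy' /(fK _ _ _ Kxy) E]; rewrite E in nCy.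
    by move=> [[y _ Kxy] nC]; exists y => //; split => // Cy; apply: nC; exists y.
  - by rewrite bigU; exact: bigcupT_measurable.
move=> U /(@metric_openF _ _ _ S)[F cF ->] /=.
by rewrite bigU; apply: bigcupT_measurable => n; exact: cK.
Qed.

Lemma functional_measurable K : functional K -> cofunctional K ->
  (forall C, metric_closed S C -> measurable (proj1 K C) /\ measurable (proj2 K C)) ->
  borel_projections K.
Proof.
move=> fK cK mK C mC; split.
  by apply: functional_proj1_measurable => // B /mK[].
apply: (@functional_proj1_measurable [set p | K (p.2, p.1)]) => //.
  by move=> y x x'; exact: cK.
by move=> B /mK[].
Qed.

Lemma measurable_proj1 E : measurable E -> exists B, [/\ measurable B,
  B `<=` proj1 E setT & mu.-negligible (proj1 E setT `\` B)].
Proof.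
move=> /(measurable_inner_compact S mu)[K [KE cK negK]].
exists (\bigcup_n proj1 (K n) setT); split => //.
  apply: bigcupT_measurable => n; apply: (@metric_closed_measurable _ _ _ S).
  by have [] := cK n _ (@metric_closedT _ _ _ S).
by move=> x [n _ [y _ /KE Exy]]; exists y.
Qed.

(** Discarding a null part of the domain makes images and preimages of Borel sets Borel, the form in
    which [pmp] can be applied. *)
Lemma injection_graph E : measurable E -> functional E -> cofunctional E ->
  exists F, [/\ F `<=` E, borel_projections F &
    mu.-negligible (proj1 E setT `\` proj1 F setT)].
Proof.
move=> /(measurable_inner_compact S mu)[K [KE cK negK]] fE cE.
pose F := \bigcup_n K n.
have FE : F `<=` E by move=> p [n _ /KE].
have F1 C : proj1 F C = \bigcup_n proj1 (K n) C.
  apply/seteqP; split => x; first by move=> [y Cy [n _ Kxy]]; exists n => //; exists y.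
  by move=> [n _ [y Cy Kxy]]; exists y => //; exists n.
have F2 C : proj2 F C = \bigcup_n proj2 (K n) C.
  apply/seteqP; split => x; first by move=> [y Cy [n _ Kxy]]; exists n => //; exists y.
  by move=> [n _ [y Cy Kxy]]; exists y => //; exists n.
exists F; split => //; last by rewrite F1.
apply: functional_measurable.
- by move=> x y y' /FE + /FE; exact: fE.
- by move=> x y y' /FE + /FE; exact: cE.
- move=> C cC; rewrite F1 F2; split; apply: bigcupT_measurable => n;
    apply: (@metric_closed_measurable _ _ _ S); by have [] := cK n _ cC.
Qed.

(** The identity off the domain of [F], which keeps the total function measurable. *)
Definition graph_fun (F : set (X * X)) (x : X) : X :=
  if pselect (exists y, F (x, y)) is left e then sval (cid e) else x.

Lemma graph_funE F x y : functional F -> F (x, y) -> graph_fun F x = y.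
Proof.
move=> fF Fxy; rewrite /graph_fun; case: pselect => [e|[]]; last by exists y.
exact: (fF x _ _ (svalP (cid e))).
Qed.

Variable adj : X -> X -> Prop.

Lemma pmp_graph F : pmp adj mu -> borel_projections F -> functional F -> cofunctional F ->
  (forall x y, F (x, y) -> connected_rel adj x y) ->
  forall C, measurable C -> mu (proj2 F C) = mu (proj1 F setT `&` C).
Proof.
move=> Hpmp bF fF cF conF.
pose A := proj1 F setT; pose B := proj2 F setT.
pose f := graph_fun F.
have fE x y : F (x, y) -> f x = y by exact: graph_funE.
have mA : measurable A by have [] := bF _ measurableT.
have imE C : C `<=` A -> f @` C = proj2 F C.
  move=> CA; apply/seteqP; split => y.
    by move=> [x Cx <-]; have [z _ Fxz] := CA _ Cx; exists x => //; rewrite (fE _ _ Fxz).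
  by move=> [x Cx /fE <-]; exists x.
move=> C mC; have -> : proj2 F C = proj2 F (A `&` C).
  apply/seteqP; split => y [x]; last by move=> [_ Cx]; exists x.
  by move=> Cx Fxy; exists x => //; split => //; exists y.
rewrite -imE; last by move=> x [].
apply: (Hpmp A B f); last by move=> x [].
- split; last first.
    by move=> D mD DA; rewrite imE//; have [] := bF _ mD.
  split => //.
  + by have [] := bF _ measurableT.
  + move=> x x'; rewrite !inE => -[y _ Fxy] [y' _ Fxy'] E.
    by apply: (cF _ _ y) => //; rewrite -(fE _ _ Fxy) E (fE _ _ Fxy').
  + by rewrite imE//; apply/seteqP; split => y [x _ Fxy]; exists x => //; exists y.
  + move=> _ D mD; rewrite (_ : _ `&` _ = proj1 F D); first by have [] := bF _ mD.
    apply/seteqP; split => x.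
      by move=> [[y _ Fxy]]; rewrite /preimage /= (fE _ _ Fxy) => Dy; exists y.
    by move=> [y Dy Fxy]; split; [exists y|rewrite /preimage /= (fE _ _ Fxy)].
- by move=> x [y _ Fxy]; rewrite (fE _ _ Fxy); exact: conF.
- exact: measurableI.
Qed.

End Graphs.

(** * Neighbours of null sets *)

Lemma cball_measurable {d} {X : measurableType d} {R : realType} (S : polish X R) i :
  measurable (cball S i).
Proof. by apply: (@metric_closed_measurable _ _ _ S); exact: cball_closed. Qed.

(** * Maps along edges into a null set have null domain *)

Section StarContradiction.
Context {d} {X : measurableType d} {R : realType} (S : polish X R).
Variable mu : probability X R.
Variable adj : X -> X -> Prop.
Hypothesis adjC : forall x y, adj x y -> adj y x.
Hypothesis adj_pmp : pmp adj mu.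
Variables (E K : set (X * X)) (N : set X).
Hypothesis mE : measurable E.
Hypothesis fE : functional E.
Hypothesis E_adj : forall x y, E (x, y) -> adj x y.
Hypothesis E_N : forall x y, E (x, y) -> N y.
Hypothesis N0 : mu.-negligible N.
Hypothesis KE : K `<=` E.
Hypothesis cK : closed_projections S K.

Local Notation dist := (pdist S).
Local Notation cball := (cball S).
Local Notation fib := (proj1 K).

Let fK : functional K.
Proof. by move=> x y y' /KE + /KE; exact: fE. Qed.

Let mfib B : measurable B -> measurable (fib B).
Proof.
apply: (@functional_proj1_measurable _ _ _ S) => // C cC.
by apply: (@metric_closed_measurable _ _ _ S); have [] := cK cC.
Qed.

Let mC : measurable (fib setT). Proof. exact: mfib. Qed.

Let fib_functional B x y : fib B x -> K (x, y) -> B y.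
Proof. by move=> [z Bz Kxz] /(fK Kxz) <-. Qed.

(** On a set meeting each fibre at most once the map is injective, so by invariance this set has, up
    to a null set, the measure of an image contained in [N]. *)
Lemma transversal_null W : measurable W -> W `<=` fib setT ->
  (forall x x' y, W x -> W x' -> K (x, y) -> K (x', y) -> x = x') -> mu W = 0%E.
Proof.
move=> mW WC Winj.
pose E1 := E `&` (W `*` setT).
have E1K x y : E1 (x, y) -> W x /\ K (x, y).
  move=> [Exy [/= Wx _]]; split => //.
  by have [z _ Kxz] := WC _ Wx; rewrite (fE Exy (KE Kxz)).
have mE1 : measurable E1 by apply: measurableI => //; exact: measurableX.
have fE1 : functional E1 by move=> x y y' [+ _] [+ _]; exact: fE.
have cE1 : cofunctional E1.
  by move=> x x' y /E1K[Wx Kxy] /E1K[Wx' Kx'y]; exact: Winj Kx'y.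
have [F [FE bF negF]] := injection_graph S mu mE1 fE1 cE1.
have F0 : mu (proj1 F setT) = 0%E.
  rewrite -[X in mu X]setIT -(@pmp_graph _ _ _ _ adj) //.
  - apply: measure_negligible; first by have [] := bF _ measurableT.
    by apply: negligibleS N0 => y [x _ /FE[/E_N]].
  - by move=> x y y' /FE + /FE; exact: fE1.
  - by move=> x y y' /FE + /FE; exact: cE1.
  - by move=> x y /FE[/E_adj ? _]; apply: rt_step (rt_refl _ _) _.
apply: measure_negligible => //.
apply: (@negligibleS _ _ _ _ (proj1 F setT `|` (proj1 E1 setT `\` proj1 F setT))).
  move=> x Wx; have [|nF] := pselect (proj1 F setT x); [by left|right; split => //].
  by have [z _ Kxz] := WC _ Wx; exists z => //; split; [exact: KE|].
apply: negligibleU => //; apply/negligibleP => //.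
by have [] := bF _ measurableT.
Qed.

(* [Y] is the essential image of [D] under the map with graph [K]. *)
Definition is_support (D Y : set X) := [/\ measurable Y, Y `<=` proj2 K D,
  mu ((D `&` fib setT) `\` fib Y) = 0%E &
  forall B, measurable B -> B `<=` Y -> mu (D `&` fib B) = 0%E -> mu (fib B) = 0%E].

(** Exhaustion: among the Borel [B] whose fibres miss [D] up to a null set, a maximizing sequence
    has a union [Bs] of largest fibre measure. Off [Bs], a further such set can only have a null
    fibre. *)
Lemma support_exists D : metric_closed S D -> exists Y, is_support D Y.
Proof.
move=> cD; have mD : measurable D := metric_closed_measurable cD.
pose I := [set mu (fib B) | B in [set B | measurable B /\ mu (D `&` fib B) = 0%E]].
have fib0 : fib set0 = set0 by apply/seteqP; split => // x [].
have I_fin : ereal_sup I \is a fin_num.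
  rewrite ge0_fin_numE; last first.
    apply: ereal_sup_ubound; exists set0; rewrite ?fib0 ?measure0//; split => //.
    by rewrite fib0 setI0 measure0.
  apply: (@le_lt_trans _ _ (mu setT)); last by rewrite probability_setT ltry.
  apply: ge_ereal_sup => _ [B [mB _] <-].
  by apply: le_measure; rewrite ?inE//; exact: mfib.
have /choice[B HB] (n : nat) : exists B, [/\ measurable B, mu (D `&` fib B) = 0%E &
    (ereal_sup I - n.+1%:R^-1%:E < mu (fib B))%E].
  have [|_ [B [mB B0] <-] lt] := @ub_ereal_sup_adherent _ I n.+1%:R^-1 _ I_fin.
    by rewrite invr_gt0.
  by exists B.
pose Bs := \bigcup_n B n.
have mBs : measurable Bs by apply: bigcupT_measurable => n; have [] := HB n.
have fibU (F : nat -> set X) : fib (\bigcup_n F n) = \bigcup_n fib (F n).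
  apply/seteqP; split => x; first by move=> [y [n _ Fy] Kxy]; exists n => //; exists y.
  by move=> [n _ [y Fy Kxy]]; exists y => //; exists n.
have Bs0 : mu (D `&` fib Bs) = 0%E.
  apply: measure_negligible; first by apply: measurableI => //; exact: mfib.
  rewrite fibU setI_bigcupr; apply: negligible_bigcup => n.
  have [mBn Bn0 _] := HB n; apply/negligibleP => //.
  by apply: measurableI => //; exact: mfib.
have supBs : (ereal_sup I <= mu (fib Bs))%E.
  apply/lee_addgt0Pr => e e0; have [n ne] := small_inv e0.
  have [mBn _ /ltW] := HB n; rewrite leeBlDr// => /le_trans; apply.
  apply: leeD; last by rewrite lee_fin ltW.
  apply: le_measure; rewrite ?inE//; try exact: mfib.
  by move=> x [y By Kxy]; exists y => //; exists n.
have mP : measurable (proj2 K D).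
  by apply: (@metric_closed_measurable _ _ _ S); have [] := cK cD.
exists (proj2 K D `\` Bs); split.
- exact: measurableD.
- by move=> x [].
- apply: (@subset_measure0 _ _ _ _ _ (D `&` fib Bs)) => //.
  + apply: measurableD; last by apply: mfib; exact: measurableD.
    exact: measurableI.
  + by apply: measurableI => //; exact: mfib.
  + move=> x [[Dx [y _ Kxy]] nf]; split => //.
    exists y => //; apply: contrapT => nB; apply: nf; exists y => //; split => //.
    by exists x.
- move=> A mA AY A0.
  have AB : fib A `&` fib Bs = set0.
    apply/seteqP; split => // x [[y Ay Kxy] /fib_functional/(_ Kxy) By].
    by have [] := AY _ Ay.
  have : (mu (fib (A `|` Bs)) <= ereal_sup I)%E.
    apply: ereal_sup_ubound; exists (A `|` Bs) => //; split; first exact: measurableU.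
    apply: measure_negligible.
      by apply: measurableI => //; apply: mfib; exact: measurableU.
    apply: (@negligibleS _ _ _ _ ((D `&` fib A) `|` (D `&` fib Bs))).
      by move=> x [Dx [y [Ay|By] Kxy]]; [left|right]; split => //; exists y.
    by apply: negligibleU; apply/negligibleP => //; apply: measurableI => //; exact: mfib.
  have -> : fib (A `|` Bs) = fib A `|` fib Bs.
    apply/seteqP; split => x; first by move=> [y [Ay|By] Kxy]; [left|right]; exists y.
    by move=> [[y ? ?]|[y ? ?]]; exists y => //; [left|right].
  rewrite measureU//; try exact: mfib.
  move=> /le_trans/(_ supBs); rewrite -leeBrDr ?fin_num_measure//; last exact: mfib.
  rewrite subee ?fin_num_measure//; last exact: mfib.
  by move=> le; apply/eqP; rewrite -measure_le0.
Qed.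

(** * The tree of cells that splits the fibres *)

Definition cells (l : seq nat) : set X := [set x | forall i, i \in l -> cball i x].

Lemma cells_closed l : metric_closed S (cells l).
Proof.
move=> x H i il; apply: cball_closed => e e0.
by have [y Hy xy] := H e e0; exists y => //; exact: Hy.
Qed.

Lemma cells_cons i l : cells (i :: l) = cball i `&` cells l.
Proof.
apply/seteqP; split => x.
  by move=> H; split => [|j jl]; apply: H; rewrite inE ?eqxx// jl orbT.
by move=> [Hi Hl] j; rewrite inE => /predU1P[->|/Hl].
Qed.

(** The second component of a ball index encodes its radius, so both radii are at most
    [1 / (n + 1)]; this makes cells shrink along a branch. *)
Definition split_pair (n : nat) (p : nat * nat) :=
  [/\ (n <= (unpair p.1).2)%N, (n <= (unpair p.2).2)%N & cball p.1 `&` cball p.2 = set0].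

Lemma split_points x x' n : x <> x' ->
  exists p, [/\ split_pair n p, cball p.1 x & cball p.2 x'].
Proof.
move=> xx'; have r0 : 0 < dist x x'.
  rewrite lt_neqAle pdist_ge0 andbT eq_sym.
  by apply/eqP => /(@pdist_eq0 _ _ _ S).
(* Each ball has diameter at most half of [dist x x'], strictly less in fact, so the two cannot
   meet. *)
have [|k ke] := @small_inv _ (dist x x' / 4); first lra.
have [i iE xi] := cball_cover S x (maxn n k).
have [j jE xj] := cball_cover S x' (maxn n k).
exists (i, j); split => //; split; rewrite /= ?iE ?jE ?leq_maxl//.
apply/seteqP; split => // z [zi zj].
have := cball_dist xi zi; have := cball_dist zj xj; rewrite iE jE.
have : (maxn n k).+1%:R^-1 <= k.+1%:R^-1 :> R.
  by rewrite lef_pV2 ?posrE ?ltr0n// ler_nat ltnS leq_maxr.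
have := pdist_triangle S z x x'.
by move: (k.+1%:R^-1) ((maxn n k).+1%:R^-1) ke => r s; lra.
Qed.

Variable Y : seq nat -> set X.
Hypothesis HY : forall l, is_support (cells l) (Y l).

Let mY l : measurable (Y l). Proof. by have [] := HY l. Qed.

Let mcells l : measurable (cells l).
Proof. exact: (metric_closed_measurable (@cells_closed l)). Qed.

(* Over [y], the two balls coded by [q] split the cell [l] into two massive parts. *)
Definition branch l q : set X :=
  [set y | split_pair (size l) (unpair q) /\
    Y ((unpair q).1 :: l) y /\ Y ((unpair q).2 :: l) y].

Lemma branch_measurable l q : measurable (branch l q).
Proof.
have [h|h] := pselect (split_pair (size l) (unpair q)).
  rewrite (_ : branch l q = Y ((unpair q).1 :: l) `&` Y ((unpair q).2 :: l)).
    exact: measurableI.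
  by apply/seteqP; split => y; [case|].
by rewrite (_ : branch l q = set0)//; apply/seteqP; split => // y [].
Qed.

Definition dead_end l := Y l `\` \bigcup_q branch l q.

Lemma dead_end_measurable l : measurable (dead_end l).
Proof.
apply: measurableD => //; apply: bigcupT_measurable => q; exact: branch_measurable.
Qed.

(* Points of a dead end whose small balls all carry mass over their image are
   separated by the map, so they form a transversal. *)
Lemma dead_end_null l : mu (fib (dead_end l)) = 0%E.
Proof.
have mdead := dead_end_measurable l.
(* The last clause of [is_support] reduces the claim to the part of the fibre inside [cells l]. *)
have [_ _ _] := HY l; apply => //; first by move=> y [].
pose V i := ~` cball i `|` fib (Y (i :: l)).
have mV i : measurable (V i).
  apply: measurableU; last exact: mfib.
  by apply: measurableC; exact: cball_measurable.
pose W := (cells l `&` fib (dead_end l)) `&` \bigcap_i V i.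
have mW : measurable W.
  apply: measurableI; last exact: bigcap_measurableType.
  by apply: measurableI => //; exact: mfib.
have W0 : mu W = 0%E.
  apply: transversal_null => //; first by move=> x [[_ [y _ Kxy]] _]; exists y.
  move=> x x' y [[lx dx] Vx] [[lx' dx'] Vx'] Kxy Kx'y.
  apply: contrapT => /(split_points (size l))[p [sp px px']].
  have [_] := fib_functional dx Kxy; apply; exists (pickle p) => //.
  rewrite /branch /= unpairK; split => //; split.
    by have [//|/fib_functional] := Vx p.1 I; apply.
  by have [//|/fib_functional] := Vx' p.2 I; apply.
apply: measure_negligible; first by apply: measurableI => //; exact: mfib.
pose Z i := (cells (i :: l) `&` fib setT) `\` fib (Y (i :: l)).
have Z0 i : mu.-negligible (Z i).
  apply/negligibleP; last by have [] := HY (i :: l).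
  by apply: measurableD; [exact: measurableI|exact: mfib].
apply: (@negligibleS _ _ _ _ (W `|` \bigcup_i Z i)); last first.
  apply: negligibleU; first exact/negligibleP.
  exact: negligible_bigcup.
move=> x [lx dx]; have [|nV] := pselect ((\bigcap_i V i) x); first by left.
right; move: nV; rewrite -[X in X -> _]/((~` \bigcap_i V i) x) setC_bigcap.
move=> [i _ /not_orP[/contrapT xi nY]]; exists i => //; split => //; split.
  by rewrite cells_cons.
by have [y _ Kxy] := dx; exists y.
Qed.

(** Over a live point every supported cell splits again, so an infinite binary tree of cells grows
    there. *)
Definition live := Y [::] `\` \bigcup_n dead_end (odflt [::] (unpickle n)).

Lemma live_measurable : measurable live.
Proof.
apply: measurableD => //; apply: bigcupT_measurable => n; exact: dead_end_measurable.
Qed.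

Lemma live_branch y l : live y -> Y l y -> exists q, branch l q y.
Proof.
move=> [_ nd] Yl; apply: contrapT => nq; apply: nd; exists (pickle l) => //.
by rewrite pickleK /=; split => // -[q _ bq]; apply: nq; exists q.
Qed.

Lemma live_full : mu.-negligible (fib setT `\` fib live).
Proof.
pose Z n := fib (dead_end (odflt [::] (unpickle n))).
apply: (@negligibleS _ _ _ _ ((cells [::] `&` fib setT) `\` fib (Y [::]) `|` \bigcup_n Z n)).
  move=> x [Cx nl]; have [[y Yy Kxy]|nY] := pselect (fib (Y [::]) x); last by left.
  right; apply: contrapT => nZ; apply: nl; exists y => //; split => // -[n _ dn].
  by apply: nZ; exists n => //; exists y.
apply: negligibleU.
  apply/negligibleP; last by have [] := HY [::].
  by apply: measurableD; [exact: measurableI|exact: mfib].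
apply: negligible_bigcup => n; apply/negligibleP; last exact: dead_end_null.
by apply: mfib; exact: dead_end_measurable.
Qed.

(* [bit i] spells the word [1^i 0 c], where [c] records which balls contain [x]: the
   prefix makes the words of distinct indices [i] differ. *)
Definition bit i n : set X :=
  if (n < i)%N then setT else if n == i then set0 else cball (n - i).-1.

Lemma bit_measurable i n : measurable (bit i n).
Proof. by rewrite /bit; case: ifP => // _; case: ifP => // _; exact: cball_measurable. Qed.

Lemma bit_inj i i' x x' : (forall n, bit i n x <-> bit i' n x') -> i = i' /\ x = x'.
Proof.
move=> H; have ii' : i = i'.
  have [lt|lt|//] := ltngtP i i'.
    by have := H i; rewrite /bit lt ltnn eqxx => -[_ []].
  by have := H i'; rewrite /bit lt ltnn eqxx => -[[]].
split => //; apply: contrapT => /(split_points 0)[p [[_ _ pp] px px']].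
(* This is the position at which the word records membership in the ball [p.1]. *)
have := H (i + p.1).+1; rewrite -{}ii' {H}/bit.
rewrite ltnNge (leq_trans (leq_addr p.1 i))//= gtn_eqF ?ltnS ?leq_addr//.
rewrite -addnS addKn /= => -[/(_ px) px1' _].
suff : set0 x' by [].
by rewrite -pp.
Qed.

(* [l] is the cell reached over the image of [x] when the word [bit i] of [x] chooses one
   half at each splitting; [seqDU] selects the first pair of balls that splits. *)
Fixpoint node i (l : seq nat) : set X :=
  if l is a :: l' then
    [set x | node i l' x /\ exists q, fib (seqDU (branch l') q) x /\
      a = if `[< bit i (size l') x >] then (unpair q).1 else (unpair q).2]
  else fib live.

Lemma seqDU_branch_measurable l q : measurable (seqDU (branch l) q).
Proof.
apply: measurableD; first exact: branch_measurable.
by apply: bigsetU_measurable => k _; exact: branch_measurable.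
Qed.

Lemma node_measurable i l : measurable (node i l).
Proof.
have cst (P : Prop) : measurable [set _ : X | P].
  have [p|p] := pselect P; first by rewrite (_ : [set _ | _] = setT)//; apply/seteqP; split.
  by rewrite (_ : [set _ | _] = set0)//; apply/seteqP; split.
elim: l => [|a l IH] /=; first by apply: mfib; exact: live_measurable.
rewrite (_ : mkset _ = node i l `&` \bigcup_q (fib (seqDU (branch l) q) `&`
    ((bit i (size l) `&` [set _ | a = (unpair q).1]) `|`
     (~` bit i (size l) `&` [set _ | a = (unpair q).2])))).
  apply: measurableI => //; apply: bigcupT_measurable => q; apply: measurableI.
    by apply: mfib; exact: seqDU_branch_measurable.
  have mb := bit_measurable i (size l).
  by apply: measurableU; apply: measurableI => //; exact: measurableC.
apply/seteqP; split => x.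
  move=> [nx [q [fq aE]]]; split => //; exists q => //; split => //.
  by move: aE; case: asboolP => b aE; [left|right].
move=> [nx [q _ [fq H]]]; split => //; exists q; split => //.
by case: asboolP H => b [] [] // + ->.
Qed.

Lemma node_live i l x y : node i l x -> K (x, y) -> live y /\ Y l y.
Proof.
move=> + Kxy; elim: l => [|a l IH] /=.
  by move=> /fib_functional/(_ Kxy) ly; split => //; have [] := ly.
move=> [/IH[ly _] [q [/fib_functional/(_ Kxy)[[_ [Y1 Y2]] _] ->]]].
by split => //; case: ifP.
Qed.

Lemma node_extend i l x : node i l x -> exists a, node i (a :: l) x.
Proof.
move=> nx; have [y Kxy] : exists y, K (x, y).
  by elim: l nx => [[y _ Kxy]|a l IH [/IH]//]; exists y.
have [ly Yy] := node_live nx Kxy; have [q bq] := live_branch ly Yy.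
have : (\bigcup_q seqDU (branch l) q) y by rewrite -seqDU_bigcup_eq; exists q.
move=> [r _ br]; exists (if `[< bit i (size l) x >] then (unpair r).1 else (unpair r).2).
by split => //; exists r; split => //; exists y.
Qed.

Lemma seqDU_branch_inj l q q' y :
  seqDU (branch l) q y -> seqDU (branch l) q' y -> q = q'.
Proof.
move=> bq bq'; apply: (@trivIset_seqDU _ (branch l)) => //; by exists y.
Qed.

Lemma node_unique i l l' x : size l = size l' -> node i l x -> node i l' x -> l = l'.
Proof.
elim: l l' => [|a l IH] [|a' l'] //= [/IH{}IH] [nl [q [fq ->]]] [/(IH nl) ll' ].
rewrite -{}ll' {IH} => -[q' [fq' ->]].
have [y Kxy] : exists y, K (x, y) by move: fq => [y _ Kxy]; exists y.
by rewrite (seqDU_branch_inj (fib_functional fq Kxy) (fib_functional fq' Kxy)).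
Qed.

(** The second point is the limit of the nested cells selected by the word of the first. *)
Definition route i : set (X * X) :=
  [set p | forall n, exists l, [/\ size l = n, node i l p.1 & cells l p.2]].

Lemma route_live i x x' : route i (x, x') -> fib live x.
Proof. by move=> /(_ 0%N)[l [/size0nil -> ? _]]. Qed.

Lemma route_measurable i : measurable (route i).
Proof.
pose dec m : seq nat := odflt [::] (unpickle m).
rewrite (_ : route i = \bigcap_n \bigcup_m
    (if size (dec m) == n then node i (dec m) `*` cells (dec m) else set0)).
  apply: bigcap_measurableType => n _; apply: bigcupT_measurable => m.
  by case: ifP => // _; apply: measurableX => //; exact: node_measurable.
apply/seteqP; split => p.
  move=> H n _; have [l [<- nl cl]] := H n; exists (pickle l) => //.
  by rewrite /dec pickleK /= eqxx.
by move=> H n; have [m _] := H n I; case: ifP => // /eqP sn [nm cm]; exists (dec m).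
Qed.

Lemma node_chain i x : fib live x -> exists l : nat -> seq nat,
  forall n, [/\ size (l n) = n, node i (l n) x & exists a, l n.+1 = a :: l n].
Proof.
move=> lx; have ex n : exists l, size l = n /\ node i l x.
  elim: n => [|n [l [<- /node_extend[a nal]]]]; first by exists [::].
  by exists (a :: l).
have [l Hl] := choice ex; exists l => n; have [sn nn] := Hl n; split => //.
have := Hl n.+1; case: (l n.+1) => [[]|a l' [[sl'] [nl' _]]] //; exists a.
by congr cons; apply: node_unique nl' nn; rewrite sl' sn.
Qed.

Lemma node_radius i l x a : node i (a :: l) x -> (size l <= (unpair a).2)%N.
Proof.
by move=> [_ [q [[y [[[? ? _] _] _] _] ->]]]; case: ifP.
Qed.

Lemma route_radius i x x' x'' n l : node i l x -> size l = n.+1 -> cells l x' -> cells l x'' ->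
  dist x' x'' <= 2 * n.+1%:R^-1.
Proof.
case: l => // a l /node_radius an [sl]; rewrite !cells_cons => -[ax' _] [ax'' _].
apply: le_trans (cball_dist ax' ax'') _; rewrite ler_pM2l//.
by rewrite lef_pV2 ?posrE ?ltr0n// ler_nat ltnS -sl.
Qed.

Lemma route_functional i : functional (route i).
Proof.
move=> x x' x'' /= H' H''.
apply: (@pdist_eq0 _ _ _ S); apply/eqP; rewrite eq_le pdist_ge0 andbT.
apply/ler_addgt0Pr => e e0; rewrite add0r.
have [|n ne] := @small_inv _ (e / 2); first lra.
have [l [sl nl cl]] := H' n.+1; have [l2 [sl2 nl2 cl2]] := H'' n.+1.
have llE : l2 = l by apply: node_unique nl2 nl; rewrite sl sl2.
rewrite llE in cl2; have := route_radius nl sl cl cl2.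
by move: (n.+1%:R^-1) ne => r; lra.
Qed.

(** Each cell on the branch supports [y] and so contains a point of the fibre of [y]. These points
    converge to [x'], and the fibre is closed. *)
Lemma route_fiber i x x' y : route i (x, x') -> K (x, y) -> K (x', y).
Proof.
move=> H Kxy; suff : proj1 K [set y] x' by move=> [_ ->].
have [+ _] := cK (@metric_closed1 _ _ _ S y); apply => e e0.
have [|n ne] := @small_inv _ (e / 2); first lra.
have [l [sl nl cl]] := H n.+1; have [ly Yy] := node_live nl Kxy.
have [_ /(_ _ Yy)[z cz Kzy] _ _] := HY l; exists z; first by exists y.
have := route_radius nl sl cl cz.
by move: (n.+1%:R^-1) ne => r; lra.
Qed.

Lemma route_total i x : fib live x -> exists x', route i (x, x').
Proof.
move=> lx; have [y ly Kxy] := lx; have [l Hl] := node_chain i lx.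
have ex n : exists z, cells (l n) z.
  have [_ nl _] := Hl n; have [_ Yy] := node_live nl Kxy.
  by have [_ /(_ _ Yy)[z cz _] _ _] := HY (l n); exists z.
have [z Hz] := choice ex.
have sub n m : (n <= m)%N -> cells (l m) `<=` cells (l n).
  move=> /subnKC <-; elim: (m - n)%N => [|k IH]; first by rewrite addn0.
  rewrite addnS; apply: subset_trans IH; have [_ _ [a ->]] := Hl (n + k)%N.
  by rewrite cells_cons => w [].
have [|x' Hx'] := pdist_complete S z.
  move=> e e0; have [|n ne] := @small_inv _ (e / 2); first lra.
  exists n.+1 => a b na nb; have [sl nl _] := Hl n.+1.
  have := route_radius nl sl (sub _ _ na _ (Hz a)) (sub _ _ nb _ (Hz b)).
  by move: (n.+1%:R^-1) ne => r; lra.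
exists x' => n; exists (l n); have [sl nl _] := Hl n; split => //=.
apply: cells_closed => e e0; have [m Hm] := Hx' e e0.
exists (z (maxn n m)); first by apply: (sub n (maxn n m)); rewrite ?leq_maxl.
by rewrite pdistC; apply: Hm; rewrite leq_maxr.
Qed.

(** Both routes stay in the fibre of one [y], and [seqDU] makes the pair chosen at a cell depend on
    [y] alone. Its halves are disjoint, so the half containing [x'] reveals each bit; the word then
    determines the index and the source. *)
Lemma route_inj i i' x1 x2 x' :
  route i (x1, x') -> route i' (x2, x') -> i = i' /\ x1 = x2.
Proof.
move=> H1 H2.
have lx1 := route_live H1; have lx2 := route_live H2.
have [y1 _ K1] := lx1; have [y2 _ K2] := lx2.
have yE := fK (route_fiber H1 K1) (route_fiber H2 K2); rewrite -{}yE in K2.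
have [l1 Hl1] := node_chain i lx1; have [l2 Hl2] := node_chain i' lx2.
have c1 n : cells (l1 n) x'.
  have [l [sl nl cl]] := H1 n; have [sl1 nl1 _] := Hl1 n.
  by rewrite (node_unique _ nl1 nl)// sl sl1.
have c2 n : cells (l2 n) x'.
  have [l [sl nl cl]] := H2 n; have [sl1 nl1 _] := Hl2 n.
  by rewrite (node_unique _ nl1 nl)// sl sl1.
have step n : l1 n = l2 n -> (bit i n x1 <-> bit i' n x2) /\ l1 n.+1 = l2 n.+1.
  move=> llE; have [s1 _ [a1 E1]] := Hl1 n; have [s2 _ [a2 E2]] := Hl2 n.
  have := c1 n.+1; have := c2 n.+1.
  have [_ + _] := Hl1 n.+1; have [_ + _] := Hl2 n.+1.
  rewrite E1 E2 -llE !cells_cons => /= -[_ [q2 [f2 a2E]]] [_ [q1 [f1 a1E]]] [x2' _] [x1' _].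
  have fy1 := fib_functional f1 K1; have fy2 := fib_functional f2 K2.
  have qE := seqDU_branch_inj fy1 fy2.
  move: a1E a2E x1' x2' fy1; rewrite -qE s1 => -> -> + + [[[_ _ dis] _] _].
  case: asboolP => b1; case: asboolP => b2 => xa xb; split => //.
    by have : set0 x' by rewrite -dis.
    by have : set0 x' by rewrite -dis.
    by have : set0 x' by rewrite -dis.
  by have : set0 x' by rewrite -dis.
have lE n : l1 n = l2 n.
  elim: n => [|n /step[]//].
  have [s1 _ _] := Hl1 0%N; have [s2 _ _] := Hl2 0%N.
  by case: (l1 0%N) s1 => //; case: (l2 0%N) s2.
by apply: bit_inj => n; have [] := step n (lE n).
Qed.

(* The routes carry [fib live] injectively to infinitely many disjoint sets, all of its
   measure by invariance. *)
Lemma live_null : mu (fib live) = 0%E.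
Proof.
have mlive : measurable (fib live) by apply: mfib; exact: live_measurable.
have /choice[F HF] (i : nat) := injection_graph S mu (route_measurable i) (@route_functional i)
  (fun x x' y h h' => (route_inj h h').2).
have bF i : borel_projections (F i) by have [] := HF i.
have FR i : F i `<=` route i by have [] := HF i.
have mF i : measurable (proj2 (F i) setT) by have [] := bF i _ measurableT.
have Fmu i : mu (proj2 (F i) setT) = mu (fib live).
  rewrite (@pmp_graph _ _ _ _ adj)//; first last.
  (* The points [x] and [x'] are joined by a path of length two through their common image [y]. *)
  - move=> x x' /FR Rxx'; have [y _ Kxy] := route_live Rxx'.
    apply: (@rt_step _ _ _ y); first by apply: rt_step (rt_refl _ _) (E_adj (KE Kxy)).
    by apply: adjC; apply: E_adj; apply: KE; exact: route_fiber Kxy.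
  - by move=> x x' y /FR h /FR h'; have [] := route_inj h h'.
  - by move=> x y y' /FR + /FR; exact: route_functional.
  have mF1 : measurable (proj1 (F i) setT) by have [] := bF i _ measurableT.
  rewrite setIT -(@measureU0 _ _ _ mu (proj1 (F i) setT) (fib live `\` proj1 (F i) setT))//.
  - rewrite setDUK//.
    by move=> x [x' _ /FR/route_live].
  - exact: measurableD.
  - have [_ _ negF] := HF i; apply: measure_negligible; first exact: measurableD.
    by apply: negligibleS negF; apply: setSD => x /(route_total i)[x' h]; exists x'.
have tF : trivIset setT (fun i => proj2 (F i) setT).
  move=> i j _ _ [x' [[x1 _ /FR h1] [x2 _ /FR h2]]].
  by have [] := route_inj h1 h2.
have le1 : (mu (\bigcup_i proj2 (F i) setT) <= 1)%E.
  by apply: probability_le1; exact: bigcupT_measurable.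
have fin : mu (fib live) \is a fin_num by exact: fin_num_measure.
apply: contrapT => /eqP m0.
have {}m0 : 0 < fine (mu (fib live)).
  by rewrite fine_gt0// lt0e m0 measure_ge0/= ltey_eq fin.
have [n nm] : exists n : nat, (fine (mu (fib live)))^-1 < n%:R.
  by exists (Num.truncn (fine (mu (fib live)))^-1).+1; rewrite truncnS_gt.
have : (\sum_(0 <= i < n) mu (proj2 (F i) setT) <= 1)%E.
  apply: le_trans le1; rewrite measure_bigcup//.
  rewrite (eq_eseriesl (Q := xpredT)); last by move=> i; rewrite in_setT.
  exact: nneseries_lim_ge.
under eq_bigr do rewrite Fmu.
rewrite -(fineK fin) sumEFin lee_fin sumr_const_nat subn0 leNgt => /negP; apply.
by rewrite -mulr_natr mulrC -ltr_pdivrMr// div1r.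
Qed.

Lemma star_null_of_supports : mu (fib setT) = 0%E.
Proof.
apply: measure_negligible => //.
apply: (@negligibleS _ _ _ _ ((fib setT `\` fib live) `|` fib live)).
  by move=> x Cx; have [|] := pselect (fib live x); [right|left].
apply: negligibleU; first exact: live_full.
by apply/negligibleP; [apply: mfib; exact: live_measurable|exact: live_null].
Qed.

End StarContradiction.

(** * Decomposition into partial injections *)

Section Decomposition.
Context {d} {X : measurableType d} {R : realType} (S : polish X R).
Variable mu : probability X R.
Variable adj : X -> X -> Prop.
Hypothesis adj_borel : borel_graph adj.
Hypothesis adj_pmp : pmp adj mu.
Local Notation dist := (pdist S).
Local Notation cball := (cball S).

Let adjC x y : adj x y -> adj y x. Proof. by have [+ _] := adj_borel; apply. Qed.

Lemma star_null (E : set (X * X)) (N : set X) : measurable E -> functional E ->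
  (forall x y, E (x, y) -> adj x y) -> (forall x y, E (x, y) -> N y) ->
  mu.-negligible N -> mu.-negligible (proj1 E setT).
Proof.
move=> mE fE E_adj E_N N0.
have [K [KE cK negK]] := measurable_inner_compact S mu mE.
apply: (@negligibleS _ _ _ _ ((proj1 E setT `\` \bigcup_n proj1 (K n) setT) `|`
    \bigcup_n proj1 (K n) setT)).
  by move=> x Ex; have [|] := pselect ((\bigcup_n proj1 (K n) setT) x); [right|left].
apply: negligibleU => //; apply: negligible_bigcup => n.
have [Y HY] := choice (fun l => support_exists mu fE (KE n) (cK n) (@cells_closed _ _ _ S l)).
apply/negligibleP.
  apply: (@metric_closed_measurable _ _ _ S).
  by have [] := cK n _ (@metric_closedT _ _ _ S).
exact: (star_null_of_supports adjC adj_pmp mE fE E_adj E_N N0 (KE n) (cK n) HY).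
Qed.

Lemma isolating_ball (s : seq X) y :
  exists i, cball i y /\ forall z, z \in s -> cball i z -> z = y.
Proof.
have [k Hk] : exists k : nat, forall z, z \in s -> dist y z <= 2 * k.+1%:R^-1 -> z = y.
  elim: s => [|z s [k Hk]]; first by exists 0%N.
  have [->|/eqP zy] := eqVneq z y.
    by exists k => w; rewrite inE => /predU1P[->|/Hk].
  have r0 : 0 < dist y z.
    by rewrite lt_neqAle pdist_ge0 andbT eq_sym; apply/eqP => /(@pdist_eq0 _ _ _ S)/esym.
  have [|m mz] := @small_inv _ (dist y z / 2); first lra.
  have lem a b : (a <= b)%N -> b.+1%:R^-1 <= a.+1%:R^-1 :> R.
    by move=> ab; rewrite lef_pV2 ?posrE ?ltr0n// ler_nat.
  have mk := lem _ _ (leq_maxl k m); have mm := lem _ _ (leq_maxr k m).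
  exists (maxn k m) => w; rewrite inE => /predU1P[->|ws] yw; last first.
    by apply: Hk ws _; apply: le_trans yw _; rewrite ler_pM2l.
  suff : dist y z < dist y z by rewrite ltxx.
  by move: (m.+1%:R^-1) ((maxn k m).+1%:R^-1) mz mm yw => u v; lra.
have [i ik yi] := cball_cover S y k; exists i; split => // z zs zi.
by apply: Hk => //; rewrite -ik; exact: cball_dist.
Qed.

Let Eadj : set (X * X) := [set p | adj p.1 p.2].
Let mEadj : measurable Eadj. Proof. by have [_ []] := adj_borel. Qed.

Definition two_neighbors (U : set X) : set X :=
  [set x | exists y y', [/\ y <> y', U y, U y', adj x y & adj x y']].

Lemma neighborhood_measurable U : measurable U -> exists Z, [/\ measurable Z,
  proj1 Eadj U `<=` Z & mu.-negligible (Z `\` proj1 Eadj U)].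
Proof.
move=> mU.
have [|B [mB BE [A [mA A0 EA]]]] := @measurable_proj1 _ _ _ S mu (Eadj `&` (setT `*` U)).
  by apply: measurableI => //; exact: measurableX.
have UE : proj1 (Eadj `&` (setT `*` U)) setT = proj1 Eadj U.
  apply/seteqP; split => x; first by move=> [y _ [Exy [_ Uy]]]; exists y.
  by move=> [y Uy Exy]; exists y.
rewrite {}UE in BE EA.
exists (B `|` A); split; first exact: measurableU.
  by move=> x Ux; have [|nB] := pselect (B x); [left|right; apply: EA].
by exists A; split => // x [[/BE//|//]].
Qed.

(** Two distinct neighbours are separated by one of countably many pairs of disjoint balls. The
    approximation is from above, so that off [Z] the neighbour in [U] is unique without
    exception. *)
Lemma two_neighbors_measurable U : measurable U -> exists Z, [/\ measurable Z,
  two_neighbors U `<=` Z & mu.-negligible (Z `\` two_neighbors U)].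
Proof.
move=> mU.
have mUb i : measurable (U `&` cball i).
  by apply: measurableI => //; exact: cball_measurable.
have [W HW] := choice (fun i => neighborhood_measurable (mUb i)).
pose W2 q := if pselect (split_pair S 0 (unpair q)) is left _ then
  W (unpair q).1 `&` W (unpair q).2 else set0.
exists (\bigcup_q W2 q); split.
- apply: bigcupT_measurable => q; rewrite /W2; case: pselect => // _.
  by apply: measurableI; [have [] := HW (unpair q).1|have [] := HW (unpair q).2].
- move=> x [y [y' [yy' Uy Uy' xy xy']]].
  have [p [sp py py']] := split_points S 0 yy'.
  exists (pickle p) => //; rewrite /W2 unpairK; case: pselect => // _; split.
    by have [_ + _] := HW p.1; apply; exists y.
  by have [_ + _] := HW p.2; apply; exists y'.
- pose Z i := W i `\` proj1 Eadj (U `&` cball i).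
  apply: (@negligibleS _ _ _ _ (\bigcup_i Z i)); last first.
    by apply: negligible_bigcup => i; have [] := HW i.
  move=> x [[q _]]; rewrite /W2; case: pselect => // -[_ _ dis] [W1 W2'] n2.
  apply: contrapT => nZ; apply: n2.
  have nb i : W i x -> proj1 Eadj (U `&` cball i) x.
    by move=> Wx; apply: contrapT => nx; apply: nZ; exists i.
  have [y [Uy y1] xy] := nb _ W1; have [y' [Uy' y2] xy'] := nb _ W2'.
  exists y, y'; split => // E; suff : set0 y by [].
  by rewrite -dis; split => //; rewrite E.
Qed.

Variable D : nat.
Hypothesis degD : {ae mu, forall x, deg_le adj x D}.

(** For almost every [x], a neighbour in [N] is isolated by a ball from the other neighbours.
    Sending [x] to the neighbour in a fixed ball is then a partial map along edges into [N], whose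
    domain is null by [star_null]. *)
Lemma neighbors_of_null N : mu N = 0%E -> measurable N ->
  mu.-negligible [set x | exists2 y, N y & adj x y].
Proof.
move=> N0 mN; have negN : mu.-negligible N by apply/negligibleP.
have mNb i : measurable (N `&` cball i).
  by apply: measurableI => //; exact: cball_measurable.
have [Z HZ] := choice (fun i => two_neighbors_measurable (mNb i)).
pose F i := Eadj `&` (~` Z i `*` (N `&` cball i)).
have Fneg i : mu.-negligible (proj1 (F i) setT).
  have [mZ ZT _] := HZ i; apply: (@star_null _ N).
  - by apply: measurableI => //; apply: measurableX => //; exact: measurableC.
  - move=> x y y' [xy [/= nZ [Ny yi]]] [xy' [/= _ [Ny' yi']]].
    by apply: contrapT => yy'; apply: nZ; apply: ZT; exists y, y'.
  - by move=> x y [].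
  - by move=> x y [_ [_ []]].
  - by [].
apply: (@negligibleS _ _ _ _ (~` [set x | deg_le adj x D] `|`
   \bigcup_i proj1 (F i) setT `|` \bigcup_i (Z i `\` two_neighbors (N `&` cball i)))).
  move=> x [y Ny xy].
  have [[s [_ sx]]|] := pselect (deg_le adj x D); last by left; left.
  have [i [yi Hi]] := isolating_ball s y.
  have [Zx|nZ] := pselect (Z i x).
    right; exists i => //; split => // -[z [z' [zz' [_ zi] [_ z'i] xz xz']]].
    by apply: zz'; rewrite (Hi z (sx _ xz) zi) (Hi z' (sx _ xz') z'i).
  by left; right; exists i => //; exists y.
apply: negligibleU; first by apply: negligibleU => //; exact: negligible_bigcup.
by apply: negligible_bigcup => i; have [] := HZ i.
Qed.

Definition edge_decomposition (F : nat -> set (X * X)) (N : set X) :=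
  [/\ forall p, [/\ borel_projections (F p), functional (F p) & cofunctional (F p)],
      forall p x y, F p (x, y) -> adj x y,
      forall p q x y, F p (x, y) -> F q (x, y) -> p = q,
      measurable N /\ mu N = 0%E &
      forall x, ~ N x -> deg_le adj x D /\ forall y, adj x y -> exists p, F p (x, y)].

(* The isolating-ball idea of Feldman and Moore: an edge is determined by either endpoint
   once the other one is confined to a ball isolating it. *)
Lemma edge_decomposition_exists : exists F N, edge_decomposition F N.
Proof.
have [Z HZ] := choice (fun i => two_neighbors_measurable (@cball_measurable _ _ _ S i)).
have mZ i : measurable (Z i) by have [] := HZ i.
have ZT i : two_neighbors (cball i) `<=` Z i by have [] := HZ i.
pose E q : set (X * X) := Eadj `&` ((cball (unpair q).1 `&` ~` Z (unpair q).2) `*`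
  (cball (unpair q).2 `&` ~` Z (unpair q).1)).
have mE q : measurable (E q).
  apply: measurableI => //; apply: measurableX;
    apply: measurableI; try exact: cball_measurable; exact: measurableC.
have fE q : functional (E q).
  move=> x y y' [xy [[_ nZ] [yi _]]] [xy' [_ [yi' _]]].
  by apply: contrapT => yy'; apply: nZ; apply: ZT; exists y, y'.
have cE q : cofunctional (E q).
  move=> x x' y [xy [[xi _] [_ nZ]]] [x'y [[x'i _] _]].
  by apply: contrapT => xx'; apply: nZ; apply: ZT; exists x, x'; split => //; exact: adjC.
pose E' := seqDU E.
have E'E q : E' q `<=` E q by apply: subDsetl.
have mE' q : measurable (E' q).
  by apply: measurableD => //; exact: bigsetU_measurable.
have fE' q : functional (E' q) by move=> x y y' /E'E + /E'E; exact: fE.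
have cE' q : cofunctional (E' q) by move=> x y y' /E'E + /E'E; exact: cE.
have [F HF] := choice (fun q => injection_graph S mu (mE' q) (fE' q) (cE' q)).
have FE q : F q `<=` E' q by have [] := HF q.
have [N1 [mN1 N10 N1P]] : mu.-negligible (~` [set x | deg_le adj x D] `|`
    \bigcup_i (Z i `\` two_neighbors (cball i)) `|`
    \bigcup_q (proj1 (E' q) setT `\` proj1 (F q) setT)).
  apply: negligibleU; last by apply: negligible_bigcup => q; have [] := HF q.
  apply: negligibleU; first exact: degD.
  by apply: negligible_bigcup => i; have [] := HZ i.
(* An edge is captured only if both ends can be isolated, so the neighbours of [N1] must be
   discarded too. *)
have [N2 [mN2 N20 N2P]] := neighbors_of_null N10 mN1.
exists F, (N1 `|` N2); split.
- move=> q; split; first by have [] := HF q.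
    by move=> x y y' /FE + /FE; exact: fE'.
  by move=> x y y' /FE + /FE; exact: cE'.
- by move=> q x y /FE/E'E[].
- move=> p q x y /FE Fp /FE Fq.
  by apply: (@trivIset_seqDU _ E) => //; exists (x, y).
- by split; [exact: measurableU|rewrite measureU0].
have good x : ~ N1 x -> deg_le adj x D /\ forall i, Z i x -> two_neighbors (cball i) x.
  move=> nx; split; first by apply: contrapT => nd; apply: nx; apply: N1P; left; left.
  by move=> i Zx; apply: contrapT => nt; apply: nx; apply: N1P; left; right; exists i.
have isolate x y : ~ N1 x -> adj x y -> exists2 i, cball i y & ~ Z i x.
  move=> /good[[s [_ sx]] Zx] xy; have [i [yi Hi]] := isolating_ball s y.
  exists i => // /Zx[z [z' [zz' zi z'i xz xz']]].
  by apply: zz'; rewrite (Hi z (sx _ xz) zi) (Hi z' (sx _ xz') z'i).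
move=> x nx; have nx1 : ~ N1 x by apply: contra_not nx; left.
split; first by have [] := good x nx1.
move=> y xy; have ny1 : ~ N1 y.
  by apply: contra_not nx => Ny; right; apply: N2P; exists y.
have [i yi nZi] := isolate x y nx1 xy.
have [j xj nZj] := isolate y x ny1 (adjC xy).
have : (\bigcup_q E q) (x, y) by exists (pickle (j, i)) => //; split => //; rewrite unpairK.
rewrite (seqDU_bigcup_eq E) => -[q _ E'xy].
have [[y' _ Fxy']|nF] := pselect (proj1 (F q) setT x).
  by exists q; rewrite (fE' q _ _ _ E'xy (FE _ _ Fxy')).
by exfalso; apply: nx1; apply: N1P; right; exists q => //; split => //; exists y.
Qed.

End Decomposition.

(** * Mass transport and the Rayleigh quotient *)

Section NonmeasurableIntegral.
Import HBNNSimple.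

(* Neither function is assumed measurable: [adj_op f] is only almost everywhere equal
   to a measurable function. *)
Lemma le_integral_off_null {d} {X : measurableType d} {R : realType}
    (mu : {measure set X -> \bar R}) (N : set X) (g1 g2 : X -> \bar R) :
  measurable N -> mu N = 0%E -> (forall x, 0 <= g2 x)%E ->
  (forall x, ~ N x -> g1 x <= g2 x)%E ->
  (\int[mu]_x g1 x <= \int[mu]_x g2 x)%E.
Proof.
move=> mN N0 g20 g12; rewrite [leRHS]ge0_integralE// patch_setT.
rewrite /integral patch_setT.
set nn := ereal_sup _.
apply: (@le_trans _ _ nn).
  rewrite -[leRHS]adde0 leeD2l// leeNl oppe0.
  by apply: ereal_sup_ubound; exists nnsfun0; [move=> x; exact: funeneg_ge0|exact: sintegral0].
apply: ge_ereal_sup => _ [h /= hg <-].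
have mNc : measurable (~` N) by exact: measurableC.
(* Cutting the simple function [h] down to the complement of [N] keeps its integral and puts it
   below [g2] everywhere. *)
have -> : sintegral mu h = sintegral mu (proj_nnsfun h mNc).
  rewrite -!integralT_nnsfun.
  rewrite (@ge0_negligible_integral _ _ _ mu setT N)//; last first.
  - by move=> x _; rewrite lee_fin.
  - by apply/measurable_EFinP.
  rewrite setTD integral_mkcond; apply: eq_integral => x _.
  by rewrite -mrestrict /patch; case: ifP.
apply: ereal_sup_ubound; exists (proj_nnsfun h mNc) => // x.
rewrite -mrestrict patchE; case: ifPn; rewrite ?g20// inE => Nx.
apply: le_trans (hg x) _; rewrite funeposE ge_max g20 andbT.
exact: g12.
Qed.

End NonmeasurableIntegral.

Section Transport.
Context {d} {X : measurableType d} {R : realType}.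
Variable mu : probability X R.
Variables (F : set (X * X)).
Hypothesis bF : borel_projections F.
Hypothesis fF : functional F.
Hypothesis muF : forall C, measurable C -> mu (proj2 F C) = mu (proj1 F setT `&` C).

Let A := proj1 F setT.
Let B := proj2 F setT.
Let mA : measurable A. Proof. by have [] := bF measurableT. Qed.
Let mB : measurable B. Proof. by have [] := bF measurableT. Qed.
Let h := graph_fun F.

Lemma graph_fun_measurable : measurable_fun setT h.
Proof.
move=> _ C mC; rewrite setTI.
rewrite (_ : _ @^-1` _ = proj1 F C `|` (C `\` A)).
  by apply: measurableU; [have [] := bF mC|exact: measurableD].
apply/seteqP; split => x; rewrite /preimage /=.
  have [[y _ Fxy]|nA] := pselect (A x).
    by rewrite /h (graph_funE fF Fxy) => Cy; left; exists y.
  rewrite /h /graph_fun; case: pselect => [[y Fxy]|_ Cx]; last by right.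
  by exfalso; apply: nA; exists y.
move=> [[y Cy Fxy]|[Cx nA]]; first by rewrite /h (graph_funE fF Fxy).
rewrite /h /graph_fun; case: pselect => [[y Fxy]|//].
by exfalso; apply: nA; exists y.
Qed.

(** Change of variables: by [muF], the pushforward under [h] of [mu] restricted to [A] agrees with
    [mu] on [B]. *)
Lemma integral_transport (g : X -> \bar R) : measurable_fun setT g ->
  (forall x, 0 <= g x)%E ->
  (\int[mu]_(x in A) g (h x) = \int[mu]_(y in B) g y)%E.
Proof.
move=> mg g0.
pose hM : {mfun X >-> X} :=
  HB.pack h (isMeasurableFun.Build _ _ _ _ h graph_fun_measurable).
have hA x : A x -> B (h x).
  by move=> [y _ Fxy]; rewrite /h (graph_funE fF Fxy); exists x.
transitivity (\int[pushforward (mrestr mu mA) hM]_(y in B) g y)%E; last first.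
  apply: eq_measure_integral => C mC CB.
  transitivity (mu (h @^-1` C `&` A)); first by [].
  have -> : h @^-1` C `&` A = proj1 F C.
    apply/seteqP; split => x.
      move=> [+ [y _ Fxy]]; rewrite /preimage /= /h (graph_funE fF Fxy) => Cy.
      by exists y.
    move=> [y Cy Fxy]; split; last by exists y.
    by rewrite /preimage /= /h (graph_funE fF Fxy).
  have mFC : measurable (proj1 F C) by have [] := bF mC.
  have := muF mFC; have -> : proj2 F (proj1 F C) = C.
    apply/seteqP; split => y.
      by move=> [x [z Cz /fF Fxz] /Fxz <-].
    by move=> Cy; have [x _ Fxy] := CB _ Cy; exists x => //; exists y.
  move=> muE; apply: (eq_trans _ (esym muE)); congr (mu _).
  by apply/esym/setIidPr => x [y _ Fxy]; exists y.
rewrite ge0_integral_pushforward//; last exact: measurable_funTS.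
rewrite -[hM @^-1` B]/(h @^-1` B).
have mhB : measurable (h @^-1` B).
  by rewrite -[X in measurable X]setTI; exact: graph_fun_measurable.
have mgh : measurable_fun setT (g \o h).
  exact: measurableT_comp mg graph_fun_measurable.
have hBA : h @^-1` B = A `|` (h @^-1` B `\` A).
  by rewrite setDUK// => x /hA.
rewrite hBA ge0_integral_setU//; first last.
- by apply/disj_setPS => x [Ax []].
- by move=> x _; exact: g0.
- exact: measurable_funTS.
- exact: measurableD.
rewrite [X in (_ + X)%E]null_set_integral//; first last.
- transitivity (mu ((h @^-1` B `\` A) `&` A)); first by [].
  by rewrite (_ : _ `&` _ = set0) ?measure0//; apply/seteqP; split => // x [[]].
- exact: measurable_funTS.
- exact: measurableD.
rewrite adde0; apply: eq_measure_integral => C mC CA.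
apply/esym; transitivity (mu (C `&` A)); first by [].
by rewrite setIidl.
Qed.

End Transport.

Section NeighborSums.
Context {d} {X : measurableType d} {R : realType}.
Variable adj : X -> X -> Prop.

Lemma neighbors_seq x n : deg_le adj x n ->
  exists s, [/\ uniq s, (size s <= n)%N & forall y, adj x y <-> y \in s].
Proof.
move=> [s [sn sx]]; exists (undup [seq y <- s | `[< adj x y >]]); split.
- exact: undup_uniq.
- by rewrite (leq_trans (size_undup _))// size_filter (leq_trans (count_size _ _)).
- move=> y; rewrite mem_undup mem_filter; split => [xy|/andP[/asboolP]//].
  by rewrite sx// andbT; apply/asboolP.
Qed.

Lemma adj_op_seq (f : X -> R) x s : uniq s -> (forall y, adj x y <-> y \in s) ->
  adj_op adj f x = \sum_(y <- s) f y.
Proof.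
move=> us sx; rewrite /adj_op (_ : neighbors adj x = [set` s]) -?fsbig_seq//.
by apply/seteqP; split => y /= /sx.
Qed.

End NeighborSums.

Section Decomposed.
Context {d} {X : measurableType d} {R : realType}.
Variable mu : probability X R.
Variable adj : X -> X -> Prop.
Hypothesis adj_borel : borel_graph adj.
Variables (D : nat) (F : nat -> set (X * X)) (N : set X).
Hypothesis HF : edge_decomposition mu adj D F N.

Let adjC x y : adj x y -> adj y x. Proof. by have [+ _] := adj_borel; apply. Qed.
Let bF p : borel_projections (F p). Proof. by have [/(_ p)[]] := HF. Qed.
Let fF p : functional (F p). Proof. by have [/(_ p)[]] := HF. Qed.
Let cF p : cofunctional (F p). Proof. by have [/(_ p)[]] := HF. Qed.
Let F_adj p x y : F p (x, y) -> adj x y. Proof. by have [_ + _ _ _] := HF; apply. Qed.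
Let F_inj p q x y : F p (x, y) -> F q (x, y) -> p = q.
Proof. by have [_ _ + _ _] := HF; apply. Qed.
Let mN : measurable N. Proof. by have [_ _ _ []] := HF. Qed.
Let N0 : mu N = 0%E. Proof. by have [_ _ _ []] := HF. Qed.
Let degN x : ~ N x -> deg_le adj x D.
Proof. by have [_ _ _ _ H] := HF; move=> /H[]. Qed.
Let coverN x y : ~ N x -> adj x y -> exists p, F p (x, y).
Proof. by have [_ _ _ _ H] := HF; move=> /H[_]; apply. Qed.
Section MassTransport.
Hypothesis adj_pmp : pmp adj mu.

Let muF p C : measurable C -> mu (proj2 (F p) C) = mu (proj1 (F p) setT `&` C).
Proof.
move=> mC; apply: (@pmp_graph _ _ _ mu adj) => // x y /F_adj xy.
exact: rt_step (rt_refl _ _) xy.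
Qed.

Let A p := proj1 (F p) setT.
Let B p := proj2 (F p) setT.
Let mA p : measurable (A p). Proof. by have [] := bF p measurableT. Qed.
Let mB p : measurable (B p). Proof. by have [] := bF p measurableT. Qed.

Section Function.
Variable g : X -> \bar R.
Hypothesis mg : measurable_fun setT g.
Hypothesis g0 : forall x, (0 <= g x)%E.

Definition moved p : X -> \bar R := (g \o graph_fun (F p)) \_ (A p).
(** A measurable substitute for the adjacency operator: off [N], each edge at [x] belongs to exactly
    one [F p]. *)
Definition neighbor_sum x := (\sum_(p <oo) moved p x)%E.

Lemma moved_ge0 p x : (0 <= moved p x)%E.
Proof. by rewrite /moved patchE; case: ifP => // _; exact: g0. Qed.

Lemma movedE p x y : F p (x, y) -> moved p x = g y.
Proof.
move=> Fxy; rewrite /moved patchE ifT /= ?(graph_funE (@fF p) Fxy)//.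
by rewrite inE; exists y.
Qed.

Lemma moved_measurable p : measurable_fun setT (moved p).
Proof.
have mh := graph_fun_measurable (bF p) (@fF p).
have mgh := measurableT_comp mg mh.
apply/(measurable_restrictT _ (mA p)).1; exact: measurable_funTS.
Qed.

Lemma neighbor_sum_ge0 x : (0 <= neighbor_sum x)%E.
Proof. by apply: nneseries_ge0 => p _ _; exact: moved_ge0. Qed.

Lemma neighbor_sum_measurable : measurable_fun setT neighbor_sum.
Proof.
apply: ge0_emeasurable_sum => [p x _ _|p _]; first exact: moved_ge0.
exact: moved_measurable.
Qed.

Lemma sum_le_neighbor_sum x s : ~ N x -> uniq s -> (forall y, y \in s -> adj x y) ->
  (\sum_(y <- s) g y <= neighbor_sum x)%E.
Proof.
move=> Nx us sx.
have ex y : exists p, y \in s -> F p (x, y).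
  have [ys|] := boolP (y \in s); last by exists 0%N.
  by have [p] := coverN Nx (sx _ ys); exists p.
have [p Hp] := choice ex.
rewrite /neighbor_sum nneseries_esumT; last by move=> q; exact: moved_ge0.
apply: esum_ge; exists [set` map p s]; first by split => //; exact: finite_seq.
rewrite -fsbig_seq; last first.
  rewrite map_inj_in_uniq// => y y' /Hp Fy /Hp Fy' E.
  by apply: (fF Fy); rewrite E.
rewrite big_map [leLHS]big_seq [leRHS]big_seq; apply: lee_sum => y ys.
by rewrite (movedE (Hp _ ys)).
Qed.

Lemma integral_moved p : (\int[mu]_x moved p x = \int[mu]_x (g \_ (B p)) x)%E.
Proof.
rewrite /moved -integral_mkcond -[RHS]integral_mkcond.
by apply: integral_transport => //; exact: muF.
Qed.

(* The injections being disjoint, distinct indices [p] with [y] in [B p] give distinct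
   neighbours of [y]. *)
Lemma sum_restrict_le y : ~ N y -> (\sum_(p <oo) (g \_ (B p)) y <= D%:R%:E * g y)%E.
Proof.
move=> Ny.
have B0 p : (0 <= (g \_ (B p)) y)%E by rewrite patchE; case: ifP.
rewrite nneseries_esumT//; apply: ge_ereal_sup => _ [J [finJ _] <-].
have [l [ul Jl]] : exists l, uniq l /\ J = [set` l].
  have [l ->] := (finite_seqP J).1 finJ; exists (undup l); split; first exact: undup_uniq.
  by apply/seteqP; split => p /=; rewrite mem_undup.
rewrite {}Jl -fsbig_seq//.
rewrite (bigID (fun p => y \in B p))/= [X in (_ + X)%E]big1_seq ?adde0; last first.
  by move=> p /andP[yB _]; rewrite patchE (negbTE yB).
pose l1 := [seq p <- l | y \in B p].
rewrite -big_filter -/l1.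
have l1P p : p \in l1 -> y \in B p by rewrite mem_filter => /andP[].
rewrite big_seq (eq_bigr (fun=> g y)); last first.
  by move=> p /l1P; rewrite patchE => ->.
rewrite -big_seq.
have ex p : exists x, p \in l1 -> F p (x, y).
  have [pl|] := boolP (p \in l1); last by exists y.
  by have := l1P _ pl; rewrite inE => -[x _ Fxy]; exists x.
have [x Hx] := choice ex.
have [s [sD sy]] := degN Ny.
have sz : (size l1 <= D)%N.
  rewrite (leq_trans _ sD)// -(size_map x); apply: uniq_leq_size.
    rewrite map_inj_in_uniq ?filter_uniq// => p q pl ql E.
    by have := Hx _ ql; rewrite -E; exact: F_inj (Hx _ pl).
  by move=> _ /mapP[p pl ->]; apply: sy; apply: adjC; exact: F_adj (Hx _ pl).
rewrite big_const_seq count_predT.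
have -> n : iter n (+%R (g y)) 0%E = (n%:R%:E * g y)%E.
  elim: n => [|n IH]; first by rewrite mul0e.
  by rewrite iterS IH -add1n natrD EFinD ge0_muleDl ?lee_fin// mul1e.
by rewrite lee_wpmul2r// lee_fin ler_nat.
Qed.

(** Mass transport: the mass [g y] collected along each [F p] is integrated over [B p] instead, and
    almost every [y] lies in at most [D] of these sets. *)
Lemma integral_neighbor_sum_le :
  (\int[mu]_x neighbor_sum x <= D%:R%:E * \int[mu]_x g x)%E.
Proof.
rewrite integral_nneseries//; last 2 first.
- exact: moved_measurable.
- by move=> p x _; exact: moved_ge0.
under eq_eseriesr do rewrite integral_moved.
rewrite -integral_nneseries//; last 2 first.
- by move=> p; apply/(measurable_restrictT _ (mB p)).1; exact: measurable_funTS.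
- by move=> p x _; rewrite patchE; case: ifP => // _; exact: g0.
rewrite -ge0_integralZl//.
apply: (le_integral_off_null mN N0) => x; first by rewrite mule_ge0.
exact: sum_restrict_le.
Qed.

End Function.

(** Bound [f x * f y] by half of [f x ^+ 2 + f y ^+ 2] on each edge. The first half is controlled by
    the degree at [x], the second by mass transport. *)
Lemma rayleigh_le (f : X -> R) : measurable_fun setT f ->
  mu.-integrable setT (fun x => (f x ^+ 2)%:E) ->
  inner mu (adj_op adj f) f <= D%:R * inner mu f f.
Proof.
move=> mf intf; pose g x := (f x * f x)%:E.
have mg : measurable_fun setT g by apply/measurable_EFinP; exact: measurable_funM.
have g0 x : (0 <= g x)%E by rewrite lee_fin -expr2 sqr_ge0.
have fing : (\int[mu]_x g x)%E \is a fin_num.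
  have -> : g = (fun x => (f x ^+ 2)%:E) by apply/funext => x; rewrite /g expr2.
  exact: integrable_fin_num.
have key (c : R) (s : seq X) : (\sum_(y <- s) f y) * c <=
    2^-1 * ((size s)%:R * (c * c) + \sum_(y <- s) f y * f y).
  elim: s => [|y s IH]; first by rewrite !big_nil !mul0r addr0 mulr0.
  rewrite !big_cons /= -[(size s).+1%:R]natr1.
  move: (size s)%:R (\sum_(j <- s) f j) (\sum_(j <- s) f j * f j) IH => n u v.
  rewrite -subr_ge0 => IH; rewrite -subr_ge0.
  rewrite (_ : _ - _ = (2^-1 * (n * (c * c) + v) - u * c) + 2^-1 * (c - f y) ^+ 2).
    by rewrite addr_ge0// mulr_ge0 ?sqr_ge0// invr_ge0.
  by field.
have le1 : (\int[mu]_x (adj_op adj f x * f x)%:E <= D%:R%:E * \int[mu]_x g x)%E.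
  pose g2 x := (2^-1%:E * (D%:R%:E * g x + neighbor_sum g x))%E.
  have Dg0 x : (0 <= D%:R%:E * g x)%E by rewrite mule_ge0.
  have ns0 x : (0 <= neighbor_sum g x)%E by exact: neighbor_sum_ge0.
  apply: (@le_trans _ _ (\int[mu]_x g2 x)%E).
    apply: (le_integral_off_null mN N0) => x.
      by rewrite mule_ge0// adde_ge0.
    move=> Nx; have [s [us sD sx]] := neighbors_seq (degN Nx).
    rewrite (adj_op_seq _ us sx).
    apply: (@le_trans _ _ (2^-1%:E * ((size s)%:R%:E * g x + \sum_(y <- s) g y))%E).
      by rewrite /g sumEFin -EFinM lee_fin; exact: key.
    rewrite lee_wpmul2l// leeD//; first by rewrite lee_wpmul2r// lee_fin ler_nat.
    by apply: sum_le_neighbor_sum => // y /sx.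
  rewrite /g2 ge0_integralZl//; last first.
  - by move=> x _; rewrite adde_ge0.
  - apply: emeasurable_funD; last exact: neighbor_sum_measurable.
    exact: measurable_funeM.
  rewrite ge0_integralD//; last first.
  - exact: neighbor_sum_measurable.
  - exact: measurable_funeM.
  rewrite ge0_integralZl//.
  have := integral_neighbor_sum_le mg g0; rewrite -(fineK fing) -EFinM.
  case: (integral _ _ (neighbor_sum g)) => [r| |] //=.
    rewrite lee_fin -EFinD -EFinM lee_fin; lra.
  by rewrite addeNy mulr_infty gtr0_sg// mul1e leNye.
rewrite /inner -/g; move: le1; rewrite -(fineK fing) -EFinM.
have : (0 <= \int[mu]_x g x)%E by apply: integral_ge0.
rewrite -(fineK fing) lee_fin => I0.
(* If the integral is [-oo], [fine] turns it into [0], which the nonnegative right-hand side still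
   bounds. *)
case: (integral _ _ (fun x => (adj_op adj f x * f x)%:E)) => [r| |] //= _.
by rewrite mulr_ge0.
Qed.

End MassTransport.

(** * Peeling into layers and greedy colouring *)

Section Coloring.
Variable S : polish X R.

Let mproj1 p U : measurable U -> measurable (proj1 (F p) U).
Proof. by move=> mU; have [] := bF p mU. Qed.

Variable k : nat.
Hypothesis k0 : (0 < k)%N.

(* The neighbours in [U] are counted by the indices of the injections leading to them,
   which makes the set visibly Borel. *)
Definition heavy (U : set X) : set X :=
  [set x | exists l : seq nat, [/\ uniq l, size l = k & forall p, p \in l -> proj1 (F p) U x]].

Lemma heavy_measurable U : measurable U -> measurable (heavy U).
Proof.
move=> mU; pose dec m : seq nat := odflt [::] (unpickle m).
rewrite (_ : heavy U = \bigcup_m (if uniq (dec m) && (size (dec m) == k) then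
    \bigcap_(p in [set` dec m]) proj1 (F p) U else set0)).
  apply: bigcupT_measurable => m; case: ifP => // _.
  by apply: bigcap_measurableType => p _; exact: mproj1.
apply/seteqP; split => x.
  move=> [l [ul sl Hl]]; exists (pickle l) => //.
  by rewrite /dec pickleK /= ul sl eqxx => p /= /Hl.
by move=> [m _]; case: ifP => // /andP[um /eqP sm] Hm; exists (dec m).
Qed.

Lemma heavyS U V : U `<=` V -> heavy U `<=` heavy V.
Proof.
move=> UV x [l [ul sl Hl]]; exists l; split => // p /Hl[y Uy Fxy].
by exists y => //; exact: UV.
Qed.

Lemma heavy_le_adj_op U x : ~ N x -> heavy U x -> k%:R <= adj_op adj (\1_U : X -> R) x.
Proof.
move=> Nx [l [ul sl Hl]]; have [s [us sD sx]] := neighbors_seq (degN Nx).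
rewrite (adj_op_seq _ us sx).
have ex p : exists y, p \in l -> U y /\ F p (x, y).
  have [/Hl[y Uy Fy]|] := boolP (p \in l); last by exists x.
  by exists y.
have [y Hy] := choice ex.
have -> : \sum_(z <- s) \1_U z = (count (fun z => z \in U) s)%:R :> R.
  rewrite -sum1_count natr_sum [RHS]big_mkcond; apply: eq_bigr => z _.
  by rewrite indicE; case: (z \in U).
rewrite ler_nat -sl -(size_map y) -size_filter; apply: uniq_leq_size.
  rewrite map_inj_in_uniq// => p q /Hy[_ Fp] /Hy[_ Fq] E.
  by apply: F_inj Fp _; rewrite E.
move=> _ /mapP[p /Hy[Uy Fy] ->]; rewrite mem_filter.
by rewrite mem_set//=; apply/sx; exact: F_adj Fy.
Qed.

Lemma light_bound U x (t : seq X) : ~ N x -> ~ heavy U x -> uniq t ->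
  (forall y, y \in t -> adj x y /\ U y) -> (size t < k)%N.
Proof.
move=> Nx nh ut Ht; rewrite ltnNge; apply/negP => kt; apply: nh.
have ex y : exists p, y \in t -> F p (x, y).
  have [/Ht[xy _]|] := boolP (y \in t); last by exists 0%N.
  by have [p] := coverN Nx xy; exists p.
have [p Hp] := choice ex.
exists (map p (take k t)); split.
- rewrite map_inj_in_uniq ?take_uniq// => y y' /mem_take /Hp Fy /mem_take /Hp Fy' E.
  by apply: fF Fy _; rewrite E.
- by rewrite size_map size_takel.
- move=> _ /mapP[y /mem_take yt ->]; exists y; last exact: Hp.
  by have [] := Ht _ yt.
Qed.

Definition colorable (U : set X) := exists c : X -> 'I_k,
  (forall i, measurable (U `&` c @^-1` [set i])) /\
  (forall x y, U x -> U y -> adj x y -> c x <> c y).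

Definition independent (W : set X) := forall x y, W x -> W y -> ~ adj x y.

(** Each new vertex takes the least colour absent from its neighbours in [U]. Independence of [W]
    prevents conflicts between new vertices, and taking the least colour makes each new class a
    Borel combination of the sets [used j]. *)
Lemma colorable_extend U W : measurable U -> measurable W -> independent W ->
  W `<=` ~` N -> (forall x, W x -> ~ heavy U x) ->
  colorable U -> colorable (U `|` W).
Proof.
move=> mU mW iW WN light [c [mc pc]].
pose used j := \bigcup_p proj1 (F p) (U `&` c @^-1` [set j]).
have mused j : measurable (used j) by apply: bigcupT_measurable => p; exact: mproj1.
have usedP x y j : W x -> U y -> adj x y -> c y = j -> used j x.
  by move=> /WN Nx Uy /(coverN Nx)[p Fxy] cy; exists p => //; exists y.
have ex x : exists j : 'I_k, (U x -> j = c x) /\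
    (W x -> ~ U x -> ~ used j x /\ forall i : 'I_k, (i < j)%N -> used i x).
  have [Ux|nUx] := pselect (U x); first by exists (c x); split.
  have [Wx|nWx] := pselect (W x); last by exists (Ordinal k0); split.
  (* If every colour were used, one neighbour per colour would give [k] distinct neighbours in [U],
     against [light_bound]. *)
  have [j0 /asboolP nj0] : exists j : 'I_k, ~ used j x.
    apply: contrapT => /forallNP H.
    have {}H j : exists y, [/\ U y, adj x y & c y = j].
      have /contrapT[p _ [y [Uy cy] Fxy]] := H j.
      by exists y; split => //; exact: F_adj Fxy.
    have [y Hy] := choice H.
    have ut : uniq (map y (enum 'I_k)).
      rewrite map_inj_uniq ?enum_uniq// => i j yij.
      by have [_ _ <-] := Hy i; have [_ _ <-] := Hy j; rewrite yij.
    have Ht z : z \in map y (enum 'I_k) -> adj x z /\ U z.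
      by move=> /mapP[j _ ->]; have [] := Hy j.
    have := light_bound (WN _ Wx) (light _ Wx) ut Ht.
    by rewrite size_map size_enum_ord ltnn.
  have [j /asboolP nj jmin] := @arg_minnP _ j0 (fun j => `[< ~ used j x >]) (fun j => val j) nj0.
  exists j; split => // _ _; split => // i ij.
  apply: contrapT => nui; have := jmin i (introT (asboolP _) nui).
  by rewrite leqNgt ij.
have [c' Hc'] := choice ex.
exists c'; split.
- move=> i; rewrite (_ : _ `&` _ = (U `&` c @^-1` [set i]) `|`
    ((W `\` U) `&` (~` used i `&` \bigcap_(j in [set j : 'I_k | (j < i)%N]) used j))).
    apply: measurableU => //; apply: measurableI; first exact: measurableD.
    apply: measurableI; first exact: measurableC.
    apply: fin_bigcap_measurable => //; exact: finite_finset.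
  apply/seteqP; split => x; have [H1 H2] := Hc' x.
    move=> [UW c'i]; have [Ux|nUx] := pselect (U x).
      by left; split => //; rewrite -c'i; exact/esym/H1.
    have Wx : W x by case: UW.
    have [nu below] := H2 Wx nUx; right; split => //; rewrite -c'i; split => //.
  move=> [[Ux <-]|[[Wx nUx] [nu ul]]]; first by split; [left|exact: H1].
  split; first by right.
  have [nu' ul'] := H2 Wx nUx; apply/val_inj; apply/eqP.
  rewrite eqn_leq leqNgt [X in _ && X]leqNgt; apply/andP; split; apply/negP => lt.
    by apply: nu; exact: ul'.
  by apply: nu'; exact: ul.
- have mixed x y : W x -> ~ U x -> U y -> adj x y -> c' x <> c' y.
    move=> Wx nUx Uy xy E; have [_ /(_ Wx nUx)[nu _]] := Hc' x.
    have [/(_ Uy) cy _] := Hc' y.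
    by apply: nu; apply: (usedP _ _ _ Wx Uy xy); rewrite E cy.
  move=> x y Hx Hy xy.
  have [Ux|nUx] := pselect (U x); have [Uy|nUy] := pselect (U y).
  + by have [/(_ Ux) -> _] := Hc' x; have [/(_ Uy) -> _] := Hc' y; exact: pc.
  + by case: Hy => // Wy E; apply: (mixed y x Wy nUy Ux (adjC xy)).
  + by case: Hx => // Wx; exact: mixed.
  + by case: Hx => // Wx; case: Hy => // Wy; have := iW _ _ Wx Wy xy.
Qed.

Definition isolated n : set X :=
  (cball S n `\` N) `\` \bigcup_p proj1 (F p) (cball S n).

Lemma isolated_measurable n : measurable (isolated n).
Proof.
apply: measurableD; first by apply: measurableD => //; exact: cball_measurable.
by apply: bigcupT_measurable => p; apply: mproj1; exact: cball_measurable.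
Qed.

Lemma isolated_independent n : independent (isolated n).
Proof.
move=> x y [[_ Nx] nx] [[yn _] _] xy; have [p Fxy] := coverN Nx xy.
by apply: nx; exists p => //; exists y.
Qed.

Lemma isolated_cover : ~` N `<=` \bigcup_n isolated n.
Proof.
move=> x Nx; have [s [_ sx]] := degN Nx.
have [i [xi Hi]] := isolating_ball S s x; exists i => //; split => //.
move=> [p _ [y yi /F_adj xy]]; have := Hi y (sx _ xy) yi => E.
by have [_ [/(_ x) irr _]] := adj_borel; apply: irr; rewrite -{2}E.
Qed.

(** What remains after [i] peelings: the points lost between [layer i] and [layer i.+1] have fewer
    than [k] neighbours in [layer i]. *)
Fixpoint layer i : set X := if i is i'.+1 then layer i' `&` heavy (layer i') else ~` N.

Lemma layer_measurable i : measurable (layer i).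
Proof.
elim: i => [|i IH] /=; first exact: measurableC.
by apply: measurableI => //; exact: heavy_measurable.
Qed.

Lemma layer_sub i : layer i `<=` ~` N.
Proof. by elim: i => // i IH x [/IH]. Qed.

Lemma layer_le i j : (i <= j)%N -> layer j `<=` layer i.
Proof.
move=> /subnKC <-; elim: (j - i)%N => [|n IH]; first by rewrite addn0.
by rewrite addnS => x [/IH].
Qed.

(* Each vertex of [layer i.+1] has at least [k] neighbours in [layer i], so the Rayleigh
   quotient of the indicator of [layer i] is at least [k mu (layer i.+1) / mu (layer i)]. *)
Lemma layer_decay (m : R) i :
  (forall f, L2_nonzero mu f -> inner mu (adj_op adj f) f <= m * inner mu f f) ->
  0 <= m ->
  k%:R * fine (mu (layer i.+1)) <= m * fine (mu (layer i)).
Proof.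
move=> Hm m0.
have mL := layer_measurable.
have fL j : mu (layer j) \is a fin_num by exact: fin_num_measure.
(* The indicator of a null layer is not an admissible test function; the next layer is then null as
   well. *)
have [L0|L0] := eqVneq (mu (layer i)) 0%E.
  rewrite L0 mulr0 (_ : mu (layer i.+1) = 0%E) ?mulr0//.
  by apply: subset_measure0 L0 => //; exact: layer_le.
pose f : X -> R := \1_(layer i).
have ff x : f x * f x = f x by rewrite /f indicE; case: (_ \in _); rewrite ?mulr1 ?mulr0.
have intf : (\int[mu]_x (f x)%:E = mu (layer i))%E.
  by rewrite /f integral_indic// setIT.
have mf : measurable_fun setT f by exact: measurable_indic.
have innerff : inner mu f f = fine (mu (layer i)).
  rewrite /inner (_ : (fun x => _) = (fun x => (f x)%:E)) ?intf//.
  by apply/funext => x; rewrite ff.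
have f2 : (fun x => (f x ^+ 2)%:E) = (fun x => (f x)%:E).
  by apply/funext => x; rewrite expr2 ff.
have L2f : L2_nonzero mu f.
  split => //; rewrite f2 ?intf//; apply: integrable_indic => //.
have {Hm} := Hm f L2f; rewrite innerff; apply: le_trans.
have f0 x : 0 <= f x by rewrite /f indicE.
have f1 x : f x <= 1 by rewrite /f indicE; case: (_ \in _).
have Tf0 x : 0 <= adj_op adj f x by apply: fsumr_ge0.
pose J := (\int[mu]_x (adj_op adj f x * f x)%:E)%E.
(* Finiteness of [J] matters because [fine] would send [+oo] to [0]. *)
have JD : (J <= D%:R%:E)%E.
  have -> : (D%:R%:E = \int[mu]_(x in setT) (D%:R%:E : \bar R))%E.
    rewrite integral_cst//; apply: (eq_trans (esym (mule1 _))); congr (_ * _)%E.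
    exact/esym/probability_setT.
  apply: (le_integral_off_null mN N0) => x; first by rewrite lee_fin.
  move=> Nx; have [s [us sD sx]] := neighbors_seq (degN Nx).
  rewrite lee_fin (le_trans (y := adj_op adj f x))//; first by rewrite ler_piMr.
  rewrite (adj_op_seq f us sx) (le_trans (ler_sum _ (G := fun=> 1) _))//.
  by rewrite big_const_seq count_predT iter_addr_0 ler_nat.
have Jk : ((k%:R * fine (mu (layer i.+1)))%:E <= J)%E.
  have -> : ((k%:R * fine (mu (layer i.+1)))%:E =
      \int[mu]_x (k%:R * \1_(layer i.+1) x)%:E)%E.
    under eq_integral do rewrite EFinM.
    rewrite ge0_integralZl//; last by apply/measurable_EFinP; exact: measurable_indic.
    by rewrite integral_indic// setIT EFinM fineK.
  apply: (@le_integral_off_null _ _ _ mu set0) => // x; first by rewrite lee_fin mulr_ge0.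
  move=> _; rewrite lee_fin indicE; have [xL|_] := boolP (_ \in _); last first.
    by rewrite mulr0 mulr_ge0.
  move: xL; rewrite inE => -[Lx hx]; rewrite mulr1 /f indicE mem_set// mulr1.
  by apply: heavy_le_adj_op => //; exact: layer_sub Lx.
rewrite /inner -/J; move: JD Jk; by case: J.
Qed.

(** The measures decay geometrically with ratio [m / k]. *)
Lemma layer_small (m e : R) :
  (forall f, L2_nonzero mu f -> inner mu (adj_op adj f) f <= m * inner mu f f) ->
  0 <= m -> m < k%:R -> 0 < e -> exists i, fine (mu (layer i)) < e.
Proof.
move=> Hm m0 mk e0; have k0' : 0 < k%:R :> R by rewrite ltr0n.
pose q := m / k%:R.
have q0 : 0 <= q by rewrite divr_ge0// ltW.
have q1 : `|q| < 1 by rewrite ger0_norm// ltr_pdivrMr// mul1r.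
have le i : fine (mu (layer i)) <= q ^+ i.
  have mL := layer_measurable.
  elim: i => [|i IH].
    rewrite expr0 -lee_fin fineK; last exact: fin_num_measure (mL 0%N).
    exact: probability_le1 (mL 0%N).
  rewrite exprS (le_trans (y := q * fine (mu (layer i))))//; last by rewrite ler_wpM2l.
  by rewrite /q mulrAC ler_pdivlMr// mulrC; exact: layer_decay.
have /cvgrPdist_lt/(_ e e0)[n _ /(_ n (leqnn n))] := cvg_expr q1.
rewrite sub0r normrN ger0_norm ?exprn_ge0// => lt.
by exists n; exact: le_lt_trans lt.
Qed.

Definition isolated_upto J := \bigcup_(n in [set n | (n < J)%N]) isolated n.

Lemma isolated_upto_measurable J : measurable (isolated_upto J).
Proof. by apply: bigcup_measurable => n _; exact: isolated_measurable. Qed.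

Lemma isolated_upto_large (e : R) : 0 < e ->
  exists J, fine (mu (~` isolated_upto J)) < e.
Proof.
move=> e0.
have : mu (~` isolated_upto J) @[J --> \oo] --> 0%E.
  have <- : mu (\bigcap_J ~` isolated_upto J) = 0%E.
    apply: (@subset_measure0 _ _ _ _ _ N) => //.
      apply: bigcap_measurableType => J _; apply: measurableC.
      exact: isolated_upto_measurable.
    move=> x Hx; apply: contrapT => /isolated_cover[n _ xn].
    by apply: (Hx n.+1 I); exists n => //=.
  have mI J : measurable (~` isolated_upto J).
    by apply: measurableC; exact: isolated_upto_measurable.
  apply: nonincreasing_cvg_mu => //.
  - by rewrite -ge0_fin_numE//; exact: fin_num_measure.
  - exact: bigcap_measurableType.
  - move=> i j ij; apply/subsetPset; apply: subsetC => x [n /= ni xn].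
    by exists n => //=; exact: leq_trans ij.
move=> /fine_cvgP[_ /cvgrPdist_lt/(_ _ e0)[J _ /(_ J)/= /(_ (leqnn J))]].
by rewrite sub0r normrN ger0_norm ?fine_ge0// => lt; exists J.
Qed.

(** Induction from the innermost layer outwards; within a layer, the independent pieces [isolated b]
    are coloured one after another. *)
Lemma colorable_layers J i n : (n <= i)%N ->
  colorable (isolated_upto J `&` (layer (i - n) `\` layer i)).
Proof.
have mL := layer_measurable.
elim: n => [_|n IH ni].
  exists (fun=> Ordinal k0); split => [j|x y]; last first.
    by rewrite subn0 => -[_ []].
  rewrite subn0 setDv setI0 set0I; exact: measurable0.
have {}IH := IH (ltnW ni).
pose j := (i - n.+1)%N.
have jE : (i - n)%N = j.+1 by rewrite /j subnSK.
rewrite jE in IH; rewrite -/j.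
pose U0 := isolated_upto J `&` (layer j.+1 `\` layer i).
have mU0 : measurable U0.
  by apply: measurableI; [exact: isolated_upto_measurable|exact: measurableD].
pose V b := U0 `|` (isolated_upto b `&` (layer j `\` layer j.+1)).
have mV b : measurable (V b).
  apply: measurableU => //; apply: measurableI; first exact: isolated_upto_measurable.
  exact: measurableD.
suff : forall b, colorable (V b).
  move=> /(_ J).
  rewrite (_ : V J = isolated_upto J `&` (layer j `\` layer i))//.
  have ij : (j < i)%N by rewrite /j -jE; rewrite leq_subr.
  apply/seteqP; split => x.
    move=> [[IJ [Lj nLi]]|[IJ [Lj nLj]]]; split => //; split => //.
      exact: layer_le Lj.
    by apply: contra_not nLj; exact: layer_le.
  move=> [IJ [Lj nLi]]; have [Lj1|nLj1] := pselect (layer j.+1 x); [left|right]; by split.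
elim=> [|b IHb].
  suff -> : V 0%N = U0 by [].
  by apply/seteqP; split => x; [move=> [//|[[]]]|left].
have -> : V b.+1 = V b `|` (isolated b `&` (layer j `\` layer j.+1)).
  apply/seteqP; split => x.
    move=> [?|[[a /= + xa] Lx]]; first by left; left.
    rewrite ltnS leq_eqVlt => /predU1P[<-|ab]; first by right.
    by left; right; split => //; exists a.
  move=> [[?|[[a /= ab xa] Lx]]|[xb Lx]]; [by left| |]; right; split => //.
    by exists a => //=; exact: ltnW.
  by exists b => /=.
apply: colorable_extend => //.
- by apply: measurableI; [exact: isolated_measurable|exact: measurableD].
- by move=> x y [xb _] [yb _]; exact: isolated_independent xb yb.
- by move=> x [[[_ ?] _] _].
(* Everything coloured so far lies in [layer j], where [x] has too few neighbours to be heavy. *)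
- move=> x [_ [Lj nLj]]; apply: contra_not nLj => hx; split => //.
  apply: heavyS hx => y [[_ [Ly _]]|[_ [Ly _]]] //.
  exact: layer_le Ly.
Qed.

Lemma ap_colorable_of_rayleigh (m : R) :
  (forall f, L2_nonzero mu f -> inner mu (adj_op adj f) f <= m * inner mu f f) ->
  0 <= m -> m < k%:R -> ap_colorable adj mu k.
Proof.
move=> Hm m0 mk eps eps0; have e2 : 0 < eps / 2 by rewrite divr_gt0.
have [i Li] := layer_small Hm m0 mk e2.
have [J IJ] := isolated_upto_large e2.
have mL := layer_measurable; have mI := isolated_upto_measurable J.
pose A := isolated_upto J `&` (layer 0 `\` layer i).
have mA : measurable A by apply: measurableI => //; exact: measurableD.
exists A; split => //.
  have : (mu (~` A) <= mu (~` isolated_upto J) + mu (layer i))%E.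
    have mIC := measurableC mI.
    (* The null set [N] enters because [layer 0] is its complement. *)
    apply: (@le_trans _ _ (mu ((~` isolated_upto J `|` layer i) `|` N))).
      apply: le_measure; rewrite ?inE//; first exact: measurableC.
        by apply: measurableU => //; exact: measurableU.
      move=> x nA; apply: contrapT => /not_orP[/not_orP[nI nL] nN].
      by apply: nA; split => //; exact: contrapT nI.
    rewrite measureU0//; last exact: measurableU.
    exact: measureU2.
  rewrite probability_setC// => le.
  have fin B : measurable B -> mu B \is a fin_num by exact: fin_num_measure.
  move: le; rewrite -(fineK (fin _ mA)) -(fineK (fin _ (mL i))).
  rewrite -(fineK (fin _ (measurableC mI))) -!EFinD lee_fin => le.
  apply: (@lt_le_trans _ _ (fine (mu A))%:E); last by rewrite fineK// fin.
  by rewrite lte_fin; lra.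
have : colorable A by have := @colorable_layers J i i (leqnn i); rewrite subnn.
move=> [c [mc pc]]; exists c; split => // j.
exists (A `&` c @^-1` [set j]); split => //.
by rewrite setDv setU0; exact: negligible_set0.
Qed.

End Coloring.

End Decomposed.

(** * The theorem *)

Lemma standard_borel_polish (d : measure_display) (X : measurableType d) (R : realType) :
  @standard_borel d X R -> inhabited (polish X R).
Proof.
move=> [dist [metric complete [u dense] borel]]; split.
exact: Polish metric complete dense borel.
Qed.

Lemma inner_gt0 (d : measure_display) (X : measurableType d) (R : realType)
    (mu : probability X R) (f : X -> R) : L2_nonzero mu f -> 0 < inner mu f f.
Proof.
move=> [mf intf nz].
rewrite /inner (_ : (fun x => (f x * f x)%:E) = (fun x => (f x ^+ 2)%:E)); last first.
  by apply/funext => x; rewrite expr2.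
rewrite fine_gt0// lt0e nz /= integral_ge0/=; last by move=> x _; rewrite lee_fin sqr_ge0.
by rewrite ltey_eq; apply/orP; left; exact: integrable_fin_num.
Qed.

Unset Implicit Arguments.

Theorem theorem5p5 (d : measure_display) (X : measurableType d) (R : realType)
    (mu : probability X R) (adj : X -> X -> Prop) :
  @standard_borel d X R ->
  borel_graph adj ->
  bounded_degree adj mu ->
  pmp adj mu ->
  exists m : R, M_adj adj mu = m%:E /\
    (chi_ap adj mu <= ((Num.floor m)%:~R + 1)%:E)%E.
Proof.
move=> /standard_borel_polish[S] adj_borel [D degD] adj_pmp.
have [F [N HF]] := edge_decomposition_exists S adj_borel adj_pmp degD.
have ub f : L2_nonzero mu f -> inner mu (adj_op adj f) f / inner mu f f <= D%:R.
  move=> L2f; rewrite ler_pdivrMr ?inner_gt0//; have [mf intf _] := L2f.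
  exact: (rayleigh_le adj_borel HF adj_pmp mf intf).
(* Testing the constant function shows that [M_adj] is nonnegative; in particular it is not
   [-oo]. *)
pose one : X -> R := fun=> 1.
have L2one : L2_nonzero mu one.
  have oneE : (fun x => (one x ^+ 2)%:E) = cst (1%:E : \bar R).
    by apply/funext => x; rewrite /one expr1n.
  split; first exact: measurable_cst.
    by rewrite oneE; apply: finite_measure_integrable_cst.
  rewrite oneE integral_cst// mul1e; apply/eqP => mu0.
  by have := probability_setT mu; rewrite mu0 => /eqP; rewrite eqe eq_sym oner_eq0.
have one0 : 0 <= inner mu (adj_op adj one) one / inner mu one one.
  rewrite divr_ge0//; last by rewrite ltW// inner_gt0.
  apply: fine_ge0; apply: integral_ge0 => x _; rewrite lee_fin mulr_ge0//.
  by apply: fsumr_ge0.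
have Mle : (M_adj adj mu <= D%:R%:E)%E.
  by apply: ge_ereal_sup => _ [f L2f <-]; rewrite lee_fin ub.
have leM f : L2_nonzero mu f ->
    ((inner mu (adj_op adj f) f / inner mu f f)%:E <= M_adj adj mu)%E.
  by move=> L2f; apply: ereal_sup_ubound; exists f.
have M0 : (0 <= M_adj adj mu)%E by apply: le_trans (leM _ L2one); rewrite lee_fin.
have finM : M_adj adj mu \is a fin_num.
  by rewrite ge0_fin_numE// (le_lt_trans Mle)// ltry.
exists (fine (M_adj adj mu)); split; first by rewrite fineK.
set m := fine _; have m0 : 0 <= m by exact: fine_ge0.
(* Since [m] is nonnegative, the absolute value only turns its integer floor into a natural number;
   the successor makes [k] exceed [m]. *)
pose k := `|Num.floor m|%N.+1.
have kE : (Num.floor m)%:~R + 1 = k%:R :> R.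
  by rewrite -natr1 natr_absz ger0_norm// floor_ge0.
rewrite kE; apply: ereal_inf_lbound; exists k => //.
apply: (@ap_colorable_of_rayleigh _ _ _ _ _ adj_borel D F N HF S k _ m) => //.
  move=> f L2f; rewrite -ler_pdivrMr ?inner_gt0// -lee_fin fineK//.
  exact: leM.
by rewrite -kE -[X in _ + X]/(1%:~R) -intrD floorD1_gt.
Qed.
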